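(* Let $\tau$ be an admissible transportation cost and let $\mu_+,\mu_-$ be nonnegative finite Borel measures on $\mathbb{R}^n$ with $\mu_+(\mathbb{R}^n)=\mu_-(\mathbb{R}^n)$ and bounded support, and let the reference space satisfy $\mathbb P(\Gamma)=\mu_+(\mathbb{R}^n)$. Then there exists an irrigation pattern $\chi$ with $J^{\tau,\mu_+,\mu_-}[\chi]<\infty$.
   Context: Transportation cost: $\tau:[0,\infty)\to[0,\infty)$, $\tau(0)=0$, $\tau(w)>0$ for $w>0$, non-decreasing, subadditive, lower semi-continuous; admissible if $\tau\le\beta$ for a concave $\beta:[0,\infty)\to[0,\infty)$ with $\int_0^1\beta(w)w^{-(2-1/n)}dw<\infty$. A reference space $(\Gamma,\mathcal B(\Gamma),\mathbb P)$ is a complete separable uncountable metric space with a positive finite atomless Borel measure $\mathbb P$. $I=[0,1]$. An irrigation pattern is a measurable $\chi:\Gamma\times I\to\mathbb{R}^n$ with $\chi_p=\chi(p,\cdot)$ absolutely continuous for $\mathbb P$-a.e. $p$; $\mu_\pm^\chi$ are the pushforwards of $\mathbb P$ under $p\mapsto\chi(p,0)$ resp. $\chi(p,1)$. $m_\chi(x)=\mathbb P(\{q:x\in\chi_q(I)\})$; $r^\tau(w)=\tau(w)/w$ ($w>0$), $r^\tau(0)=\lim_{w\downarrow0}\tau(w)/w$; $J^\tau(\chi)=\int_{\Gamma\times I}r^\tau(m_\chi(\chi(p,t)))|\dot\chi(p,t)|\,d\mathbb P\,dt$; $J^{\tau,\mu_+,\mu_-}[\chi]=J^\tau(\chi)$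 if $\mu_\pm^\chi=\mu_\pm$ and $+\infty$ otherwise. *)

(* Defs.v *)
From HB Require Import structures.
From mathcomp Require Import all_boot all_order all_algebra.
From mathcomp Require Import all_classical all_reals all_analysis.
Set Implicit Arguments. Unset Strict Implicit. Unset Printing Implicit Defensive.
Import Order.TTheory GRing.Theory Num.Theory numFieldNormedType.Exports.
Local Open Scope classical_set_scope.
Local Open Scope ring_scope.

Definition borel (T : topologicalType) := g_sigma_algebraType (@open T).

Section Irrigation.
Variable R : realType.

Definition enorm (n : nat) (v : 'rV[R]_n) : R :=
  Num.sqrt (\sum_(i < n) v ord0 i ^+ 2).

Definition I01 : set R := [set t | 0 <= t <= 1].
Definition oc01 : set R := [set t | 0 < t <= 1].

Definition transportation_cost (tau : R -> R) : Prop :=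
  [/\ tau 0 = 0,
      (forall w, 0 < w -> 0 < tau w),
      (forall v w, 0 <= v -> v <= w -> tau v <= tau w),
      (forall v w, 0 <= v -> 0 <= w -> tau (v + w) <= tau v + tau w)
    & (forall w, 0 <= w -> forall a, a < tau w ->
         exists2 d, 0 < d & forall v, 0 <= v -> `|v - w| < d -> a < tau v)].

Definition concave_on_nonneg (beta : R -> R) : Prop :=
  forall x y t, 0 <= x -> 0 <= y -> 0 <= t -> t <= 1 ->
    t * beta x + (1 - t) * beta y <= beta (t * x + (1 - t) * y).

Definition admissible (n : nat) (tau : R -> R) : Prop :=
  transportation_cost tau /\
  exists beta : R -> R,
    [/\ (forall w, 0 <= w -> 0 <= beta w),
        concave_on_nonneg beta,
        (forall w, 0 <= w -> tau w <= beta w)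
      & (\int[lebesgue_measure]_(w in oc01) (beta w * w `^ (- (2 - n%:R^-1)))%:E
           < +oo)%E].

Definition rtau (tau : R -> R) (w : R) : \bar R :=
  if w == 0 then lim ((fun v => (tau v / v)%:E) @ at_right 0)
  else (tau w / w)%:E.

Definition reference_space (Gamma : completePseudoMetricType R)
    (P : {measure set (borel Gamma) -> \bar R}) : Prop :=
  [/\ hausdorff_space Gamma,                                   (* metric, not pseudo *)
      (exists D : set Gamma, countable D /\ closure D = setT),
      ~ countable [set: Gamma],
      (0 < P setT < +oo)%E
    & (forall A : set (borel Gamma), measurable A -> (0 < P A)%E ->
         exists B : set (borel Gamma),
           [/\ measurable B, B `<=` A, (0 < P B)%E & (P B < P A)%E])].

Definition abs_cont01 (n : nat) (f : R -> 'rV[R]_n) : Prop :=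
  forall e, 0 < e -> exists2 d, 0 < d &
    forall (k : nat) (a b : 'I_k -> R),
      (forall i, [/\ 0 <= a i, a i <= b i & b i <= 1]) ->
      (forall i j, i != j -> (b i <= a j) \/ (b j <= a i)) ->
      \sum_(i < k) (b i - a i) < d ->
      \sum_(i < k) enorm (f (b i) - f (a i)) < e.

Variables (Gamma : completePseudoMetricType R) (n : nat).
Variable (P : {measure set (borel Gamma) -> \bar R}).

Definition irrigation_pattern (chi : Gamma -> R -> 'rV[R]_n) : Prop :=
  measurable_fun (setT `*` I01)
    (fun z : borel Gamma * R => (chi z.1 z.2 : borel 'rV[R]_n)) /\
  {ae P, forall p, abs_cont01 (chi p)}.

(* m_chi(x) = P({q : x in chi_q(I)}), taken as the (outer) measure, i.e.
   the infimum of P over measurable supersets. *)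
Definition mass (chi : Gamma -> R -> 'rV[R]_n) (x : 'rV[R]_n) : \bar R :=
  ereal_inf [set P B | B in [set B : set (borel Gamma) |
     measurable B /\ [set q | (chi q @` I01) x] `<=` B]].

Definition Jtau (tau : R -> R) (chi : Gamma -> R -> 'rV[R]_n) : \bar R :=
  (\int[(P \x lebesgue_measure)%E]_(z in setT `*` I01)
     (rtau tau (fine (mass chi (chi z.1 z.2))) *
      (enorm (derive1 (chi z.1) z.2))%:E))%E.

Definition Jtau_mu (tau : R -> R) (mup mum : {measure set (borel 'rV[R]_n) -> \bar R})
    (chi : Gamma -> R -> 'rV[R]_n) : \bar R :=
  if `[< (forall B : set (borel 'rV[R]_n), measurable B ->
            pushforward P (fun p => (chi p 0 : borel 'rV[R]_n)) B = mup B) /\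
         (forall B : set (borel 'rV[R]_n), measurable B ->
            pushforward P (fun p => (chi p 1 : borel 'rV[R]_n)) B = mum B) >]
  then Jtau tau chi else +oo%E.

End Irrigation.

Definition msupport (R : realType) (n : nat)
    (mu : {measure set (borel 'rV[R]_n) -> \bar R}) : set 'rV[R]_n :=
  [set x | forall r : R, 0 < r -> (0 < mu (ball x r))%E].

(* Main.v *)
Require Import Defs.
From mathcomp Require Import all_boot all_order all_algebra.
From mathcomp Require Import all_classical all_reals all_analysis.
From mathcomp Require Import measurable_realfun.
From mathcomp Require Import ring lra zify.
Import Order.TTheory GRing.Theory Num.Theory numFieldNormedType.Exports.
Set Implicit Arguments. Unset Strict Implicit. Unset Printing Implicit Defensive.
Local Open Scope classical_set_scope.
Local Open Scope ring_scope.

(** Put both measures in a cube of side [S]. Since [P] is atomless, Sierpinski's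
    theorem lets one copy, one bit at a time, the joint law under [mu] of the
    binary digits of the coordinates of a point: this gives measurable sets in
    [Gamma] whose membership bits at [p] are the digits of a point of law [mu].
    The particle [p] travels along the polygonal line through the successive
    dyadic truncations of its point, spending time [2^-(k+2)] on the step from
    level [k] to level [k+1]; this keeps the speed bounded. It climbs from its
    [mu_+]-point to the root and descends to its [mu_-]-point.

    On step [k] all particles sharing the first [k+1] digits travel together,
    so the multiplicity is at least the mass [v] of their cell, and the cost rate
    is at most [beta v / v] because [beta] is concave. Summing over the [2^m]
    cells of level [k], where [m = (k+1)n], Jensen's inequality bounds the cost
    of step [k] by a multiple of [2^-k 2^m beta (2^-m)], and these numbers are
    summable because [beta w * w^-(2-1/n)] is integrable at [0]. *)

(** * Finite atomless measures and Sierpinski's intermediate value theorem *)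

Definition atomless {d} {T : measurableType d} {R : realType}
    (P : set T -> \bar R) : Prop :=
  forall A, measurable A -> (0 < P A)%E ->
    exists B, [/\ measurable B, B `<=` A, (0 < P B)%E & (P B < P A)%E].

Section FiniteAtomlessMeasure.
Context {d : measure_display} {T : measurableType d} {R : realType}.
Variable P : {measure set T -> \bar R}.
Hypothesis Pfin : (P setT < +oo)%E.

Local Notation m A := (fine (P A)).

Lemma finite_measure_fin_num (A : set T) : measurable A -> P A \is a fin_num.
Proof.
move=> mA; rewrite ge0_fin_numE//; apply: le_lt_trans Pfin.
by apply: le_measure; rewrite ?inE.
Qed.
Local Notation fin := finite_measure_fin_num.

Lemma fine_measureK (A : set T) : measurable A -> (m A)%:E = P A.
Proof. by move=> mA; rewrite fineK// fin. Qed.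

Lemma fine_measure_le (A B : set T) :
  measurable A -> measurable B -> A `<=` B -> m A <= m B.
Proof.
move=> mA mB AB; rewrite fine_le ?fin//.
by apply: le_measure; rewrite ?inE.
Qed.

Lemma fine_measureD (A B : set T) :
  measurable A -> measurable B -> B `<=` A -> m (A `\` B) = m A - m B.
Proof.
move=> mA mB BA; rewrite measureD// ?setIidr//; last first.
  by rewrite -ge0_fin_numE ?fin.
by rewrite fineB ?fin.
Qed.

Hypothesis Patomless : atomless P.

(** Atomlessness gives a piece of smaller positive mass; that piece or its complement has at most
    half the mass, and halving is iterated until the mass drops below [e]. *)
Lemma atomless_small (A : set T) (e : R) :
  measurable A -> (0 < m A) -> 0 < e ->
  exists B, [/\ measurable B, B `<=` A, 0 < m B & m B < e].
Proof.
move=> mA A0 e0.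
have halving k : exists B, [/\ measurable B, B `<=` A, 0 < m B & m B * 2 ^+ k <= m A].
  elim: k => [|k [B [mB BA B0 Bk]]]; first by exists A; split; rewrite ?expr0 ?mulr1.
  have [|C [mC CB C0 CltB]] := Patomless mB.
    by rewrite -fine_measureK// lte_fin.
  rewrite -fine_measureK// lte_fin in C0.
  rewrite -(fine_measureK mB) -(fine_measureK mC) lte_fin in CltB.
  have [le|lt] := leP (m C * 2) (m B).
    exists C; split => //; first exact: subset_trans BA.
    by rewrite exprS mulrA (le_trans _ Bk)// ler_wpM2r// exprn_ge0.
  have mBC : measurable (B `\` C) by exact: measurableD.
  exists (B `\` C); split => //.
  - by apply: subset_trans BA; apply: subDsetl.
  - by rewrite fine_measureD// subr_gt0.
  rewrite exprS mulrA (le_trans _ Bk)// ler_wpM2r ?exprn_ge0//.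
  by rewrite fine_measureD// mulrBl; lra.
pose k := (Num.truncn (m A / e)).+1.
have [B [mB BA B0 Bk]] := halving k.
exists B; split => //.
rewrite -(ltr_pM2r (exprn_gt0 k (ltr0Sn R 1))) (le_lt_trans Bk)//.
rewrite mulrC -ltr_pdivrMr// (@lt_le_trans _ _ k%:R)//.
  exact: truncnS_gt.
by rewrite -natrX ler_nat ltnW// ltn_expl.
Qed.

(** [B'] adds to [B] a set whose mass exceeds half the supremum of the masses that still fit under
    [c]; the factor 2 records this near-optimality. When the supremum is 0, [B'] is [B]. *)
Lemma greedy_step (A B : set T) (c : R) :
  measurable A -> measurable B -> B `<=` A -> m B <= c ->
  exists B', [/\ measurable B', B `<=` B', B' `<=` A, m B' <= c &
    forall C, measurable C -> C `<=` A `\` B -> m C <= c - m B ->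
      m C <= 2 * (m B' - m B)].
Proof.
move=> mA mB BA Bc.
pose S := [set m C | C in [set C | [/\ measurable C, C `<=` A `\` B & m C <= c - m B]]].
have S0 : S 0.
  exists set0; last by rewrite measure0.
  by split => //; rewrite measure0 /= subr_ge0.
have Ssup : has_sup S.
  by split; [exists 0 | exists (c - m B) => _ [C [_ _ ?] <-]].
have [s0|s0] := leP (sup S) 0.
  exists B; split => // C mC CAB Cc; rewrite subrr mulr0.
  by apply: le_trans s0; apply: ub_le_sup; [exact: (Ssup.2)|exists C].
have [_ [C [mC CAB Cc] <-] Cs] := sup_adherent (divr_gt0 s0 (ltr0Sn R 1)) Ssup.
have mBC : measurable (B `|` C) by exact: measurableU.
have BC : m (B `|` C) = m B + m C.
  have -> : m C = m ((B `|` C) `\` B).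
    by congr (m _); apply/seteqP; split => x; [move=> Cx; split; [right|by case: (CAB _ Cx)]|case=> -[]].
  by rewrite fine_measureD// addrC subrK.
exists (B `|` C); split => //.
- by move=> x [/BA//|/CAB[]].
- by rewrite BC -lerBrDl.
move=> D mD DAB Dc; rewrite BC addrAC subrr add0r.
have : m D <= sup S by apply: ub_le_sup; [exact: (Ssup.2)|exists D].
by lra.
Qed.

(* Sierpinski's theorem, by greedy exhaustion: a positive gap between the mass
   reached and [c] would leave room for a fixed set at every step, so every
   step would have gained at least half its mass. *)
Lemma atomless_intermediate (A : set T) (c : R) :
  measurable A -> 0 <= c <= m A ->
  exists B, [/\ measurable B, B `<=` A & m B = c].
Proof.
move=> mA /andP[c0 cA].
pose X := {B : set T | [/\ measurable B, B `<=` A & m B <= c]}.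
pose Rel (x y : X) := sval x `<=` sval y /\
  forall C, measurable C -> C `<=` A `\` sval x -> m C <= c - m (sval x) ->
      m C <= 2 * (m (sval y) - m (sval x)).
have step (x : X) : {y : X | Rel x y}.
  apply: cid; case: x => B [mB BA Bc].
  have [B' [mB' BB' B'A B'c H]] := greedy_step mA mB BA Bc.
  by exists (exist _ B' (And3 mB' B'A B'c)).
have x0P : [/\ measurable (set0 : set T), set0 `<=` A & m set0 <= c].
  by rewrite measure0; split.
have [f [f0 fS]] := dependent_choice step (exist _ set0 x0P).
pose F k := sval (f k).
have mF k : measurable (F k) by rewrite /F; case: (f k) => ? [].
have FA k : F k `<=` A by rewrite /F; case: (f k) => ? [].
have Fc k : m (F k) <= c by rewrite /F; case: (f k) => ? [].
have mUF : measurable (\bigcup_k F k) by exact: bigcupT_measurable.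
have ndF : {homo F : i j / (i <= j)%N >-> (i <= j)%O}.
  apply: homo_leq => [//|y x z|k]; first exact: le_trans.
  by rewrite subsetEset; exact: (fS k).1.
have cvgF := nondecreasing_cvg_mu mF mUF ndF.
have UFc : m (\bigcup_k F k) <= c.
  rewrite -lee_fin fine_measureK//; apply: (cvge_to_le (cvgF _ P)).
  by near=> k => /=; rewrite -fine_measureK// lee_fin.
have UFA : \bigcup_k F k `<=` A by move=> x [k _ /FA].
exists (\bigcup_k F k); split => //; apply/eqP; rewrite eq_le UFc leNgt/=.
apply/negP => ltc.
have [|||C [mC CA C0 Cc]] := @atomless_small (A `\` \bigcup_k F k) (c - m (\bigcup_k F k)).
- exact: measurableD.
- by rewrite fine_measureD// subr_gt0 (lt_le_trans ltc).
- by rewrite subr_gt0.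
have gain k : m C <= 2 * (m (F k.+1) - m (F k)).
  apply: (fS k).2 => //.
    by move=> x /CA [Ax nUx]; split => // Fx; apply: nUx; exists k.
  apply: (le_trans (ltW Cc)); rewrite lerD2l lerN2; apply: fine_measure_le => //; first exact: mF.
  by move=> x Fx; exists k.
have grow k : k%:R * (m C) <= 2 * m (F k).
  elim: k => [|k IH]; first by rewrite mul0r mulr_ge0// fine_ge0.
  by rewrite -natr1 mulrDl mul1r; have := gain k; lra.
have := grow (Num.truncn (2 * c / m C)).+1; apply/negP; rewrite -ltNge.
apply: (@le_lt_trans _ _ (2 * c)); first by rewrite ler_pM2l.
by rewrite -ltr_pdivrMr// truncnS_gt.
Unshelve. all: by end_near. Qed.

End FiniteAtomlessMeasure.

(** * Binary words of membership bits and the tree of cells they index *)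

Section Words.
Context {T : Type}.
Implicit Types A : nat -> set T.

(* Most recent bit first. *)
Fixpoint word A (K : nat) (p : T) : seq bool :=
  if K is K'.+1 then `[< A K' p >] :: word A K' p else [::].

Definition cell A (w : seq bool) : set T := [set p | word A (size w) p = w].

Lemma size_word A K p : size (word A K p) = K.
Proof. by elim: K => //= K ->. Qed.

Lemma cell_word A K p : cell A (word A K p) p.
Proof. by rewrite /cell/= size_word. Qed.

Lemma cell_nil A : cell A [::] = setT.
Proof. by apply/seteqP; split. Qed.

Lemma cell_cons_true A w : cell A (true :: w) = cell A w `&` A (size w).
Proof.
apply/seteqP; split => p; rewrite /cell/=; first by case=> /asboolP.
by case=> -> ?; congr cons; apply/asboolP.
Qed.

Lemma cell_cons_false A w : cell A (false :: w) = cell A w `\` A (size w).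
Proof.
apply/seteqP; split => p; rewrite /cell/=; first by case=> /asboolPn.
by case=> -> ?; congr cons; apply/asboolPn.
Qed.

Lemma word_eq A K L p q : (L <= K)%N -> word A K p = word A K q ->
  word A L p = word A L q.
Proof.
elim: K => [|K IH]; first by rewrite leqn0 => /eqP ->.
by rewrite leq_eqVlt => /predU1P[->//|LK] [_ /IH]; apply.
Qed.

Lemma word_bit A K j p q : (j < K)%N -> word A K p = word A K q -> A j p = A j q.
Proof.
move=> jK /(word_eq jK)/= -[e _]; apply/propext.
by split => /asboolP; [rewrite e|rewrite -e] => /asboolP.
Qed.

Lemma word_preimageE A K (S : set (seq bool)) :
  [set p | S (word A K p)] = \bigcup_(w in [set w | size w = K /\ S w]) cell A w.
Proof.
apply/seteqP; split => p /=.
  by move=> Sp; exists (word A K p); [rewrite /= size_word|exact: cell_word].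
by move=> [w /= [<- Sw] ->].
Qed.

End Words.

Lemma finite_words (K : nat) (S : set (seq bool)) :
  finite_set [set w : seq bool | size w = K /\ S w].
Proof.
apply: (@sub_finite_set _ _ [set val t | t in [set: K.-tuple bool]]).
  by move=> w /= [/eqP sw _]; exists (Tuple sw).
exact/finite_image/finite_finset.
Qed.

Lemma trivIset_cell T (A : nat -> set T) K S :
  trivIset [set w : seq bool | size w = K /\ S w] (cell A).
Proof. by move=> v w [/= <- _] [/= sw _] [p [<- ]]; rewrite /cell /= sw. Qed.

Section WordsMeasure.
Context {d : measure_display} {T : measurableType d} {R : realType}.
Variable A : nat -> set T.
Hypothesis mA : forall j, measurable (A j).

Lemma measurable_cell w : measurable (cell A w).
Proof.
elim: w => [|[] w IH]; first by rewrite cell_nil.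
  by rewrite cell_cons_true; exact: measurableI.
by rewrite cell_cons_false; exact: measurableD.
Qed.

Lemma measure_word (P : {measure set T -> \bar R}) K S :
  P [set p | S (word A K p)] =
  (\sum_(w \in [set w | size w = K /\ S w]) P (cell A w))%E.
Proof.
rewrite word_preimageE measure_fin_bigcup//; first exact: finite_words.
  exact: trivIset_cell.
by move=> w _; exact: measurable_cell.
Qed.

End WordsMeasure.

(** * Copying the joint law of a sequence of sets onto an atomless space *)

Section TransportBits.
Context {d : measure_display} {T : measurableType d} {R : realType}.
Context {d' : measure_display} {X : measurableType d'}.
Variables (P : {measure set T -> \bar R}) (mu : {measure set X -> \bar R}).
Hypotheses (Pfin : (P setT < +oo)%E) (Patomless : atomless P).
Hypothesis Pmu : P setT = mu setT.
Variable E : nat -> set X.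
Hypothesis mE : forall j, measurable (E j).

(** The default [set0] of [xget] is never met for measurable [C] and [0 <= c <= P C], by
    Sierpinski's theorem. *)
Let sel (C : set T) (c : \bar R) : set T :=
  xget set0 [set B | [/\ measurable B, B `<=` C & P B = c]].

Let selP C c : measurable C -> (0 <= c <= P C)%E ->
  [/\ measurable (sel C c), sel C c `<=` C & P (sel C c) = c].
Proof.
move=> mC /andP[c0 cC]; rewrite /sel; case: xgetP => [? -> //|/= none].
have cfin : c \is a fin_num.
  by rewrite ge0_fin_numE// (le_lt_trans cC)// -ge0_fin_numE// finite_measure_fin_num.
have [|B [mB BC Bc]] := @atomless_intermediate _ _ _ P Pfin Patomless C (fine c) mC.
  by rewrite fine_ge0// fine_le// finite_measure_fin_num.
case: (none B); split => //.
by rewrite -(fine_measureK Pfin)// Bc fineK.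
Qed.

Let select (w : seq bool) (C : set T) := sel C (mu (cell E (true :: w))).

(** A binary tree of sets in [T]: the set at [v] is cut into a piece with the [mu]-mass of
    [cell E (true :: v)] and the rest, which by subtraction gets the mass of the [false] child. *)
Fixpoint lifted_cell (w : seq bool) : set T :=
  match w with
  | [::] => setT
  | true :: v => select v (lifted_cell v)
  | false :: v => lifted_cell v `\` select v (lifted_cell v)
  end.

Lemma lifted_cellP w :
  measurable (lifted_cell w) /\ P (lifted_cell w) = mu (cell E w).
Proof.
elim: w => [|b w [mw IH]]; first by rewrite cell_nil; split; [exact: measurableT|exact: Pmu].
have mEw := measurable_cell mE w.
have mEtw := measurable_cell mE (true :: w).
have [|ms ss Ps] := @selP (lifted_cell w) (mu (cell E (true :: w))) mw.
  rewrite measure_ge0 IH/=; apply: le_measure; rewrite ?inE//.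
  by rewrite cell_cons_true; apply: subIsetl.
case: b => /=; first by split.
split; first exact: measurableD.
have lfin : (P (lifted_cell w) < +oo)%E.
  by rewrite -ge0_fin_numE// finite_measure_fin_num.
have Efin : (mu (cell E w) < +oo)%E by rewrite -IH.
rewrite /select measureD// cell_cons_false measureD//.
rewrite -cell_cons_true (setIidr ss); congr (_ - _)%E; [exact: IH|exact: Ps].
Qed.

(** Collecting the [true] children of all words of length [j] turns the tree into a sequence of sets
    whose [j]-th bit decides the branching at depth [j]. The trivial conjunct matches the shape of
    [finite_words]. *)
Let lift (j : nat) : set T :=
  \bigcup_(w in [set w | size w = j /\ True]) lifted_cell (true :: w).

Lemma lifted_cell_subset v : select v (lifted_cell v) `<=` lifted_cell v.
Proof.
have [|_ ss _] := @selP (lifted_cell v) (mu (cell E (true :: v))) (lifted_cellP v).1;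
  last exact: ss.
rewrite measure_ge0 (lifted_cellP v).2/=.
apply: le_measure; rewrite ?inE; try exact: measurable_cell.
by rewrite cell_cons_true; apply: subIsetl.
Qed.

(** Induction is on the length, because a point of [lift (size w)] comes from some [v] of the same
    length; the induction hypothesis at [v] and at [w] shows that both are the bit word of the
    point, hence equal. *)
Lemma lifted_cellE w : lifted_cell w = cell lift w.
Proof.
have [K] := ubnP (size w); elim: K w => // K IH [_|b w /ltnSE wK].
  by rewrite cell_nil.
have IHw := IH w wK.
have liftE p : lifted_cell w p -> lift (size w) p = lifted_cell (true :: w) p.
  move=> wp; apply/propext; split => [[v [/= vw _] vp]|tp]; last by exists w.
  have := lifted_cell_subset vp; rewrite (IH v) ?vw// /cell/= => vp'.
  rewrite IHw /cell/= in wp.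
  have e : v = w by rewrite -[LHS]vp' vw.
  by rewrite -e.
case: b wK => wK; rewrite ?cell_cons_true ?cell_cons_false -IHw/=.
  apply/seteqP; split => p; last by case=> wp; rewrite liftE.
  by move=> tp; have wp := lifted_cell_subset tp; split; rewrite ?liftE.
by apply/seteqP; split => p [wp]; move=> H; split => //; rewrite liftE// in H *.
Qed.

Lemma transport_bits : exists A : nat -> set T, (forall j, measurable (A j)) /\
  forall K (S : set (seq bool)),
    P [set p | S (word A K p)] = mu [set x | S (word E K x)].
Proof.
have mlift j : measurable (lift j).
  apply: fin_bigcup_measurable; first exact: finite_words.
  by move=> w _; exact: (lifted_cellP _).1.
exists lift; split => // K S.
rewrite !measure_word//; apply: eq_fsbigr => w _.
by rewrite -lifted_cellE (lifted_cellP w).2.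
Qed.

End TransportBits.

(** * Borel sets of row vectors: generators, uniqueness of measures, the null complement of the
    support *)

Section BorelRowVectors.
Context {R : realType} {n : nat}.
Local Notation rV := ('rV[R]_n).

(** Countably many boxes in the role of a base; they are half-open so as to be finite intersections
    of differences of open half-spaces. *)
Definition rbox (c : {ffun 'I_n -> rat * rat}) : set rV :=
  [set x | forall i, ratr (c i).1 < x ord0 i <= ratr (c i).2].

Lemma rbox_sub_ball (x : rV) (r : R) : 0 < r ->
  exists2 c, rbox c x & rbox c `<=` ball x r.
Proof.
move=> r0.
have ex i : exists q : rat * rat, x ord0 i - r < ratr q.1 /\ ratr q.1 < x ord0 i
    /\ x ord0 i < ratr q.2 /\ ratr q.2 < x ord0 i + r.
  have [|a] := @rat_in_itvoo R (x ord0 i - r) (x ord0 i); first by rewrite ltrBlDr ltrDl.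
  rewrite in_itv/= => /andP[a1 a2].
  have [|b] := @rat_in_itvoo R (x ord0 i) (x ord0 i + r); first by rewrite ltrDl.
  rewrite in_itv/= => /andP[b1 b2].
  by exists (a, b).
have [f fP] := choice ex.
exists [ffun i => f i] => [i|y /= yb]; rewrite ?ffunE.
  by have [_ [-> [/ltW ->]]] := fP i.
split=> // i j; rewrite (ord1 i) /ball/=.
have := yb j; rewrite ffunE; have [? [? [? ?]]] := fP j.
by move=> /andP[? ?]; rewrite ltr_norml; apply/andP; split; lra.
Qed.

Lemma coord_norm_le (x : rV) (i : 'I_n) : `|x ord0 i| <= `|x|.
Proof.
rewrite [leRHS]mx_normrE.
exact: (le_bigmax _ (fun ij : 'I_1 * 'I_n => `|x ij.1 ij.2|) (ord0, i)).
Qed.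

Lemma countable_rbox_code : countable [set: {ffun 'I_n -> rat * rat}].
Proof. exact: countableP. Qed.

Lemma open_rboxE (U : set rV) : open U ->
  U = \bigcup_c (if `[< rbox c `<=` U >] then rbox c else set0).
Proof.
move=> oU; apply/seteqP; split => x.
  move=> Ux; move: oU; rewrite openE => /(_ x Ux) /nbhs_ballP[r /= r0 rU].
  have [c cx cb] := rbox_sub_ball x r0; exists c => //.
  by rewrite asboolT//; apply: subset_trans rU.
by move=> [c _]; case: asboolP => // + cx; apply.
Qed.

(** An open set is a countable union of rational boxes, and the preimage of a box is a finite
    intersection of coordinate preimages. *)
Lemma measurable_fun_rV {d} {T : measurableType d} (D : set T) (f : T -> rV) :
  measurable D -> (forall i, measurable_fun D (fun t => f t ord0 i)) ->
  measurable_fun D (f : T -> borel rV).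
Proof.
move=> mD mf; apply: (@measurability _ _ _ (borel rV) _ _ (@open rV)) => //.
move=> _ [U oU <-]; rewrite (open_rboxE oU) preimage_bigcup setI_bigcupr.
apply: countable_bigcupT_measurable; first exact: countable_rbox_code.
move=> c; case: asboolP => _; last by rewrite preimage_set0 setI0.
have -> : D `&` f @^-1` rbox c = D `&` \bigcap_(i in [set: 'I_n])
    (D `&` (fun t => f t ord0 i) @^-1` `]ratr (c i).1, ratr (c i).2]).
  apply/seteqP; split => t [Dt].
    by move=> H; split => // i _; split => //=; rewrite in_itv/=; exact: H.
  by move=> H; split => // i; have [_] := H i I; rewrite /= in_itv.
apply: measurableI => //; apply: fin_bigcap_measurable => // i _.
by apply: mf => //; exact: measurable_itv.
Qed.

Lemma measurable_coord (i : 'I_n) :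
  measurable_fun [set: borel rV] (fun x : borel rV => (x : rV) ord0 i).
Proof.
apply: (measurability _ (RGenOInfty.measurableE R)) => _ [_ [a ->] <-].
rewrite setTI; apply: sub_sigma_algebra.
apply: (@open_comp _ _ (fun x : rV => x ord0 i)); last exact: interval_open.
by move=> x _; exact: coord_continuous.
Qed.

Lemma measurable_rbox c : @measurable _ (borel rV) (rbox c).
Proof.
rewrite (_ : rbox c = \bigcap_(i in [set: 'I_n])
    ((fun x : borel rV => (x : rV) ord0 i) @^-1` `]ratr (c i).1, ratr (c i).2])); last first.
  by apply/seteqP; split => x H i => [_|]; have := H i; rewrite /= in_itv//= => /(_ I).
apply: fin_bigcap_measurable => // i _; rewrite -[X in measurable X]setTI.
by apply: measurable_coord => //; exact: measurable_itv.
Qed.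

(** With extended real bounds, [-oo] drops a constraint: half-spaces and the whole space are
    orthants, and the family is closed under intersection by taking componentwise maxima. *)
Definition orthant (c : 'I_n -> \bar R) : set rV :=
  [set x | forall i, (c i < (x ord0 i)%:E)%E].

Lemma measurable_orthant c : @measurable _ (borel rV) (orthant c).
Proof.
rewrite (_ : orthant c = \bigcap_(i in [set: 'I_n])
   ((fun x : borel rV => ((x : rV) ord0 i)%:E) @^-1` `]c i, +oo[)); last first.
  by apply/seteqP; split => x H i => [_|]; have := H i; rewrite /= in_itv/= andbT => // /(_ I).
apply: fin_bigcap_measurable => // i _; rewrite -[X in measurable X]setTI.
have /measurable_EFinP := measurable_coord i.
by apply => //; exact: emeasurable_itv.
Qed.

(** Orthants form a pi-system generating the Borel sets; as [setT] is an orthant of finite mass, the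
    constant sequence [setT] exhausts the space. *)
Lemma borel_rV_measure_unique (m1 m2 : {measure set (borel rV) -> \bar R}) :
  (forall c, m1 (orthant c) = m2 (orthant c)) -> (m1 setT < +oo)%E ->
  forall B : set (borel rV), measurable B -> m1 B = m2 B.
Proof.
move=> m12 m1fin.
pose G := [set orthant c | c in [set: 'I_n -> \bar R]].
have GT : G setT.
  by exists (fun=> -oo%E) => //; apply/seteqP; split => // x _ i; rewrite ltNyr.
apply: (@measure_unique _ R (borel rV) G (fun=> setT)) => //.
- apply/seteqP; split; last first.
    apply: smallest_sub; first exact: sigma_algebra_measurable.
    by move=> _ [c _ <-]; exact: measurable_orthant.
  apply: smallest_sub; first exact: smallest_sigma_algebra.
  move=> U oU; rewrite (open_rboxE oU).
  change (@measurable _ (g_sigma_algebraType G)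
    (\bigcup_c (if `[< rbox c `<=` U >] then rbox c else set0))).
  apply: countable_bigcupT_measurable; first exact: countable_rbox_code.
  move=> c; case: asboolP => // _.
  pose half i (a : R) := orthant (fun j => if j == i then a%:E else -oo%E).
  have halfE i a (x : rV) : half i a x = (a < x ord0 i).
    apply/propext; split => [/(_ i)|ax j]; first by rewrite eqxx.
    by case: eqP => [->//|_]; rewrite ltNyr.
  rewrite (_ : rbox c = \bigcap_(i in [set: 'I_n])
      (half i (ratr (c i).1) `\` half i (ratr (c i).2))); last first.
    apply/seteqP; split => x H i => [_|].
      by have /andP[? ?] := H i; split; rewrite halfE//; apply/negP; rewrite -leNgt.
    by have [//|] := H i; rewrite !halfE => -> /negP; rewrite -leNgt.
  apply: fin_bigcap_measurable => // i _.
  by apply: measurableD; apply: sub_sigma_algebra; eexists.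
- move=> _ _ [a _ <-] [b _ <-]; exists (fun i => maxe (a i) (b i)) => //.
  apply/seteqP; split => x.
    by move=> H; split => i; have := H i; rewrite gt_max => /andP[].
  by move=> [Ha Hb] i; rewrite gt_max Ha Hb.
- by rewrite bigcup_const.
- by move=> _ [c _ <-]; exact: m12.
Qed.

Lemma measurable_outside_box (r : R) :
  @measurable _ (borel rV) [set x : rV | exists i, r < `|x ord0 i|].
Proof.
rewrite (_ : [set x : rV | _] = \bigcup_(i in [set: 'I_n])
    ((fun x : borel rV => `|(x : rV) ord0 i|) @^-1` `]r, +oo[)); last first.
  apply/seteqP; split => x; first by move=> [i ri]; exists i => //=; rewrite in_itv/= andbT.
  by move=> [i _ /=]; rewrite in_itv/= andbT; exists i.
apply: fin_bigcup_measurable => // i _; rewrite -[X in measurable X]setTI.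
have mi : measurable_fun [set: borel rV] (fun x : borel rV => `|(x : rV) ord0 i|).
  by apply: measurableT_comp => //; exact: measurable_coord.
by apply: mi.
Qed.

(** A Lindelof argument: each point off the support has a null ball, hence lies in a null rational
    box, and there are countably many of those. *)
Lemma bounded_msupport_null (mu : {measure set (borel rV) -> \bar R}) :
  bounded_set (msupport mu) ->
  exists M : R, forall r, M <= r -> mu [set x : rV | exists i, r < `|x ord0 i|] = 0.
Proof.
(* [bounded_set] bounds the norms by any number strictly above [M], whence [M + 1]. *)
move=> [M [_ HM]]; exists (M + 1) => r Mr.
set N := [set x : rV | _].
have mN : @measurable _ (borel rV) N by exact: measurable_outside_box.
apply/(negligibleP _ mN).
pose F (j : nat) : set (borel rV) :=
  if unpickle j is Some c then (if `[< mu (rbox c) = 0 >] then rbox c else set0) else set0.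
have sNF : N `<=` \bigcup_j F j.
  move=> x [i ri].
  have : ~ msupport mu x.
    move=> sx; have := HM (M + 1); rewrite ltrDl ltr01 => /(_ isT x sx) xM.
    by move: ri; rewrite ltNge (le_trans (coord_norm_le x i))// (le_trans xM).
  move=> /existsNP[e /not_implyP[e0 /negP]]; rewrite -leNgt => ball0.
  have [c cx cb] := rbox_sub_ball x e0.
  exists (pickle c) => //; rewrite /F pickleK asboolT//.
  apply/eqP; rewrite eq_le measure_ge0 andbT (le_trans _ ball0)//.
  apply: le_measure; rewrite ?inE//.
    exact: measurable_rbox.
  by apply: sub_sigma_algebra; exact: ball_open.
apply: (@negligibleS _ (borel rV) R mu (\bigcup_j F j) N sNF).
apply: negligible_bigcup => j; rewrite /F; case: unpickle => [c|]; last exact: negligible_set0.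
case: asboolP => c0; last exact: negligible_set0.
by exists (rbox c); split => //; exact: measurable_rbox.
Qed.

End BorelRowVectors.

(** * Binary digits and the path from a number to 0 through its truncations *)

Section Digits.
Context {R : realType}.
Implicit Types (u s : R) (b : nat -> bool) (k K : nat).

(** On [[0, 1)] this is the map [2 u mod 1], whose orbit reads off the binary digits. *)
Definition doubling u : R := 2 * u - (2^-1 <= u)%R%:R.

Definition digit u k : bool := 2^-1 <= iter k doubling u.

(* [tent k] is [2^-(k+1)] for [s <= 2^-(k+1)], [0] for [s >= 2^-k], and affine of
   slope [-1] in between; the sum over [k < K] telescopes. *)
Definition tent k s : R :=
  Num.max (2^-1 ^+ k - s) 0 - Num.max (2^-1 ^+ k.+1 - s) 0.

Definition partial b K s : R := \sum_(k < K) (b k)%:R * tent k s.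

(** At [s = 0] this is the number with binary digits [b], at [s = 2^-K] its truncation to [K]
    digits, and it is affine between consecutive powers. *)
Definition limb b s : R := limn (fun K => partial b K s).

Lemma half_exp_gt0 k : 0 < 2^-1 ^+ k :> R.
Proof. by rewrite exprn_gt0// invr_gt0. Qed.

Lemma half_expS k : 2^-1 ^+ k.+1 * 2 = 2^-1 ^+ k :> R.
Proof. by rewrite exprSr -mulrA mulVf ?mulr1// pnatr_eq0. Qed.

Lemma half_exp_le k K : (k <= K)%N -> 2^-1 ^+ K <= 2^-1 ^+ k :> R.
Proof.
move=> kK; apply: ler_wiXn2l => //.
by rewrite invf_le1// ler1n.
Qed.

Lemma tent_ge0 k s : 0 <= tent k s.
Proof.
rewrite subr_ge0 ge_max le_max lerD2r half_exp_le//=.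
by rewrite le_max lexx orbT.
Qed.

Lemma tent_nonincr k s s' : s <= s' -> tent k s' <= tent k s.
Proof.
rewrite /tent => ss'; have := half_expS k; have := half_exp_gt0 k.+1.
move: (2^-1 ^+ k.+1) (2^-1 ^+ k) => y x y0 xy.
have [?|?] := leP (x - s) 0; have [?|?] := leP (x - s') 0;
have [?|?] := leP (y - s) 0; have [?|?] := leP (y - s') 0; lra.
Qed.

Lemma tent_0 k : tent k 0 = 2^-1 ^+ k.+1.
Proof.
rewrite /tent !subr0 !max_l ?(ltW (half_exp_gt0 _))// -(half_expS k).
by rewrite mulr_natr mulr2n addrK.
Qed.

Lemma tent_eq0 k s : 2^-1 ^+ k <= s -> tent k s = 0.
Proof.
move=> ks; rewrite /tent !max_r ?subr0// subr_le0// (le_trans _ ks)//.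
exact: half_exp_le.
Qed.

Lemma sum_tent K s : \sum_(k < K) tent k s = Num.max (1 - s) 0 - Num.max (2^-1 ^+ K - s) 0.
Proof.
elim: K => [|K IH]; first by rewrite big_ord0 expr0 subrr.
by rewrite big_ord_recr/= IH /tent addrA subrK.
Qed.

(** Each tent is nonincreasing, so the drop is largest when all digits are 1, and then the sum
    telescopes to a 1-Lipschitz function. *)
Lemma partial_lip_le b K s s' : s <= s' ->
  0 <= partial b K s - partial b K s' <= s' - s.
Proof.
move=> ss'; rewrite /partial -sumrB; apply/andP; split.
  apply: sumr_ge0 => k _; rewrite -mulrBr mulr_ge0// subr_ge0.
  exact: tent_nonincr.
apply: (@le_trans _ _ (\sum_(k < K) (tent k s - tent k s'))).
  apply: ler_sum => k _; rewrite -mulrBr.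
  have h : 0 <= tent k s - tent k s' by rewrite subr_ge0 tent_nonincr.
  by rewrite ler_piMl//; case: (b k); rewrite ?ler01.
rewrite sumrB !sum_tent.
have [?|?] := leP (1 - s) 0; have [?|?] := leP (1 - s') 0;
have [?|?] := leP (2^-1 ^+ K - s) 0; have [?|?] := leP (2^-1 ^+ K - s') 0; 
have := half_exp_le (leq0n K); rewrite expr0; lra.
Qed.

Lemma partial_nondecr b s : {homo (fun K => partial b K s) : K L / (K <= L)%N >-> K <= L}.
Proof.
apply: homo_leq => [//|y x z|K]; first exact: le_trans.
by rewrite /partial big_ord_recr/= lerDl mulr_ge0// tent_ge0.
Qed.

Lemma partial_bounded b K s : partial b K s <= Num.max (1 - s) 0.
Proof.
apply: (@le_trans _ _ (\sum_(k < K) tent k s)).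
  by apply: ler_sum => k _; rewrite ler_piMl ?tent_ge0//; case: (b k); rewrite ?ler01.
by rewrite sum_tent gerBl le_max lexx orbT.
Qed.

Lemma partial_is_cvg b s : cvgn (fun K => partial b K s).
Proof.
apply: nondecreasing_is_cvgn; first exact: partial_nondecr.
by exists (Num.max (1 - s) 0) => _ [K _ <-]; exact: partial_bounded.
Qed.

Lemma partial_cvg b s : partial b K s @[K --> \oo] --> limb b s.
Proof. exact: partial_is_cvg. Qed.

Lemma partial_le_limb b K s : partial b K s <= limb b s.
Proof.
exact: (nondecreasing_cvgn_le (@partial_nondecr b s) (@partial_is_cvg b s) K).
Qed.

Lemma limb_lip b s s' : `|limb b s - limb b s'| <= `|s - s'|.
Proof.
wlog ss' : s s' / s <= s'.
  move=> H; have [/H//|/ltW/H] := leP s s'.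
  by rewrite distrC [in X in _ <= X]distrC.
have c : (partial b K s - partial b K s') @[K --> \oo] --> limb b s - limb b s'.
  by apply: cvgB; exact: partial_cvg.
have -> : `|s - s'| = s' - s by rewrite distrC ger0_norm ?subr_ge0.
rewrite ler_norml; apply/andP; split.
  apply: (@le_trans _ _ 0); first by rewrite oppr_le0 subr_ge0.
  apply: (cvgr_to_ge c); near=> K.
  by have /andP[] := partial_lip_le b K ss'.
apply: (cvgr_to_le c); near=> K.
by have /andP[] := partial_lip_le b K ss'.
Unshelve. all: by end_near. Qed.

(** The tents of index at least [K] vanish at [s]. This is what makes particles with common leading
    digits travel together. *)
Lemma limb_agree b b' K s : 2^-1 ^+ K <= s -> (forall k, (k < K)%N -> b k = b' k) ->
  limb b s = limb b' s.
Proof.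
move=> Ks bb'; congr (limn _); apply/funext => L; apply: eq_bigr => k _.
have [kK|Kk] := ltnP k K; first by rewrite bb'.
by rewrite tent_eq0 ?mulr0// (le_trans _ Ks)// half_exp_le.
Qed.

Lemma limb_ge1 b s : 1 <= s -> limb b s = 0.
Proof.
move=> s1; rewrite /limb (_ : (fun K => _) = fun=> 0) ?lim_cst//.
apply/funext => K; apply: big1 => k _.
by rewrite tent_eq0 ?mulr0// (le_trans _ s1)// -(expr0 2^-1) half_exp_le.
Qed.

(** The limit is the supremum of nondecreasing partial sums, so a strict lower bound shows at a
    finite stage; the strict inequalities of [orthant] exploit this. *)
Lemma lt_limb b s (c : R) : c < limb b s <-> exists K, c < partial b K s.
Proof.
split; last by move=> [K cK]; apply: lt_le_trans cK (partial_le_limb _ _ _).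
move=> cl; apply: contrapT => /forallNP H.
suff : limb b s <= c by rewrite leNgt cl.
apply: (cvgr_to_le (@partial_cvg b s)); near=> K.
by rewrite leNgt; apply/negP; exact: H.
Unshelve. all: by end_near. Qed.

Lemma digit_expansion u K : 0 <= u < 1 ->
  u = partial (digit u) K 0 + 2^-1 ^+ K * iter K doubling u
  /\ 0 <= iter K doubling u < 1.
Proof.
move=> u01; elim: K => [|K [uE IH]]; first by rewrite /partial big_ord0 add0r expr0 mul1r.
rewrite /partial big_ord_recr/= -/(partial _ _ _) tent_0 {1}uE /digit /doubling.
move: IH; move: (iter K _ u) => v /andP[v0 v1].
rewrite -(half_expS K); move: (2^-1 ^+ K.+1) => y.
split; first by ring.
by case: (leP 2^-1 v) => h; rewrite ?mulr1n ?mulr0n ?subr0; apply/andP; split; lra.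
Qed.

Lemma limb_digit u : 0 <= u < 1 -> limb (digit u) 0 = u.
Proof.
move=> u01; apply/cvg_lim => //; apply/cvgrPdist_lt => e e0.
have : 2^-1 ^+ K @[K --> \oo] --> (0 : R).
  by apply: cvg_expr; rewrite ger0_norm ?invr_ge0// invf_lt1// ltr1n.
move=> /cvgrPdist_lt /(_ e e0); apply: filterS => K.
rewrite sub0r normrN ger0_norm ?(ltW (half_exp_gt0 _))// => Ke.
have [uE /andP[v0 v1]] := digit_expansion K u01.
rewrite {1}uE addrAC subrr add0r ger0_norm ?mulr_ge0 ?(ltW (half_exp_gt0 _))//.
by apply: le_lt_trans Ke; rewrite ler_piMr// ?(ltW (half_exp_gt0 _))// ltW.
Qed.

Lemma measurable_digit k : measurable [set u | digit u k].
Proof.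
have md : measurable_fun setT doubling.
  apply: measurable_funB; first exact: measurable_funM.
  rewrite (_ : (fun u => _) = \1_(`[2^-1, +oo[)); first exact: measurable_indic.
  by apply/funext => u; rewrite indicE mem_setE in_itv/= andbT.
have mi : measurable_fun setT (iter k doubling).
  by elim: k => [|k IH]; [exact: measurable_id|exact: measurableT_comp].
rewrite (_ : [set u | _] = iter k doubling @^-1` `[2^-1, +oo[).
  by rewrite -[X in measurable X]setTI; exact: mi.
by apply/seteqP; split => u /=; rewrite in_itv/= andbT.
Qed.

Lemma measurable_tent k : measurable_fun setT (tent k).
Proof.
by apply: measurable_funB; apply: measurable_maxr => //; apply: measurable_funB.
Qed.

End Digits.

(** * Coding points of a cube by sequences of bits *)

Lemma nth_rev_word T (A : nat -> set T) K p j : (j < K)%N ->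
  nth false (rev (word A K p)) j = `[< A j p >].
Proof.
elim: K => // K IH; rewrite /= rev_cons nth_rcons size_rev size_word.
by rewrite ltnS leq_eqVlt => /predU1P[->|jK]; rewrite ?ltnn ?eqxx ?jK ?IH.
Qed.

Lemma measurable_limb {R : realType} {d} {T : measurableType d} (D : set T)
    (b : T -> nat -> bool) (s : T -> R) :
  (forall k, measurable_fun D (fun z => (b z k)%:R : R)) -> measurable_fun D s ->
  measurable_fun D (fun z => limb (b z) (s z)).
Proof.
move=> mb ms.
apply: (@measurable_fun_cvg _ _ _ _ (fun K z => partial (b z) K (s z))).
  move=> K; apply: measurable_sum => k; apply: measurable_funM => //.
  by apply: measurableT_comp => //; exact: measurable_tent.
by move=> z _; exact: partial_cvg.
Qed.

Section Decode.
Context {R : realType} {n : nat}.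
Variables (a S : R).
Hypothesis S0 : 0 < S.

(** The digits of the [n] coordinates are interleaved, so that the first [K * n] bits hold exactly
    the first [K] digits of every coordinate. *)
Definition bits T (A : nat -> set T) (p : T) (i : 'I_n) (k : nat) : bool :=
  `[< A (k * n + i)%N p >].

Definition decode (e : 'I_n -> nat -> bool) : 'rV[R]_n :=
  \row_i (a + S * limb (e i) 0).

Lemma bits_eq T (A : nat -> set T) K p q i k : (k < K)%N ->
  word A (K * n) p = word A (K * n) q -> bits A p i k = bits A q i k.
Proof.
move=> kK wpq; rewrite /bits (word_bit _ wpq)//.
by rewrite (@leq_trans (k.+1 * n))// ?leq_mul2r ?kK ?orbT// mulSnr ltn_add2l.
Qed.

Lemma measurable_bits {d} {T : measurableType d} (A : nat -> set T) i k :
  (forall j, measurable (A j)) -> measurable_fun setT (fun p => (bits A p i k)%:R : R).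
Proof.
move=> mA; rewrite (_ : (fun p => _) = \1_(A (k * n + i)%N)); first exact: measurable_indic.
by apply/funext => p; rewrite indicE /bits; congr (_%:R); apply/asboolP/idP; rewrite inE.
Qed.

(** The stages found for the single coordinates are merged by taking their maximum, since partial
    sums are nondecreasing in [K]. *)
Lemma orthant_decode (c : 'I_n -> \bar R) e : orthant c (decode e) <->
  exists K, forall i, (c i < (a + S * partial (e i) K 0)%:E)%E.
Proof.
split; last first.
  move=> [K HK] i; rewrite mxE (lt_le_trans (HK i))// lee_fin lerD2l ler_pM2l//.
  exact: partial_le_limb.
move=> H.
have ex i : exists K, (c i < (a + S * partial (e i) K 0)%:E)%E.
  have := H i; rewrite mxE; case: (c i) => [r| |]; first last.
  - by exists 0%N; rewrite ltNyr.
  - by rewrite ltNge leey.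
  rewrite lte_fin -ltrBlDl -ltr_pdivrMl// => /lt_limb[K HK].
  by exists K; rewrite lte_fin -ltrBlDl -ltr_pdivrMl.
have [f fP] := choice ex.
exists (\max_i f i) => i; rewrite (lt_le_trans (fP i))// lee_fin lerD2l ler_pM2l//.
by apply: partial_nondecr; exact: leq_bigmax.
Qed.

Lemma measurable_decode {d} {T : measurableType d} (A : nat -> set T) :
  (forall j, measurable (A j)) ->
  measurable_fun setT (fun p => decode (bits A p) : borel 'rV[R]_n).
Proof.
move=> mA; apply: measurable_fun_rV => // i.
rewrite [X in measurable_fun _ X](_ : _ = fun p => a + S * limb (bits A p i) 0); last first.
  by apply/funext => p; rewrite mxE.
apply: measurable_funD => //; apply: measurable_funM => //.
by apply: measurable_limb => // k; exact: measurable_bits.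
Qed.

Lemma cvg_orthant_decode {d} {T : measurableType d} (P : {measure set T -> \bar R})
    (A : nat -> set T) c : (forall j, measurable (A j)) ->
  P [set p | forall i, (c i < (a + S * partial (bits A p i) K 0)%:E)%E] @[K --> \oo]
    --> P [set p | orthant c (decode (bits A p))].
Proof.
move=> mA.
pose F K := [set p | forall i, (c i < (a + S * partial (bits A p i) K 0)%:E)%E].
have -> : [set p | orthant c (decode (bits A p))] = \bigcup_K F K.
  apply/seteqP; split => p; first by move=> /orthant_decode[K ?]; exists K.
  by move=> [K _ ?]; apply/orthant_decode; exists K.
have mF K : measurable (F K).
  rewrite (_ : F K = \bigcap_(i in [set: 'I_n])
     ((fun p => (a + S * partial (bits A p i) K 0)%:E) @^-1` `]c i, +oo[)); last first.
    by apply/seteqP; split => x H i => [_|]; have := H i; rewrite /= in_itv/= andbT => // /(_ I).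
  apply: fin_bigcap_measurable => // i _; rewrite -[X in measurable X]setTI.
  have mp : measurable_fun setT (fun p => a + S * partial (bits A p i) K 0).
    apply: measurable_funD => //; apply: measurable_funM => //.
    by apply: measurable_sum => k; apply: measurable_funM => //; exact: measurable_bits.
  by have /measurable_EFinP := mp; apply => //; exact: emeasurable_itv.
apply: nondecreasing_cvg_mu => //; first exact: bigcupT_measurable.
apply: homo_leq => [//|y x z|K]; first exact: le_trans.
rewrite subsetEset => p H i; apply: lt_le_trans (H i) _.
by rewrite lee_fin lerD2l ler_pM2l// partial_nondecr.
Qed.

(** The stage-[K] events depend on [K * n] bits only, so they have equal mass; continuity from below
    carries this to the limit. *)
Lemma decode_law {d d'} {T : measurableType d} {X : measurableType d'}
    (P : {measure set T -> \bar R}) (mu : {measure set X -> \bar R})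
    (A : nat -> set T) (E : nat -> set X) (c : 'I_n -> \bar R) :
  (forall j, measurable (A j)) -> (forall j, measurable (E j)) ->
  (forall K (Q : set (seq bool)),
    P [set p | Q (word A K p)] = mu [set x | Q (word E K x)]) ->
  P [set p | orthant c (decode (bits A p))] = mu [set x | orthant c (decode (bits E x))].
Proof.
move=> mA mE law.
have cA := @cvg_orthant_decode _ _ P A c mA.
have cE := @cvg_orthant_decode _ _ mu E c mE.
apply: (cvg_unique _ cA) => //.
rewrite (_ : (fun K => P _) = fun K =>
  mu [set p | forall i, (c i < (a + S * partial (bits E p i) K 0)%:E)%E])//.
apply/funext => K.
(* [Q] reads the digits off the reversed word, because words list the latest bit first. *)
pose Q w := forall i : 'I_n,
  (c i < (a + S * partial (fun k => nth false (rev w) (k * n + i)%N) K 0)%:E)%E.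
have QE T' (A' : nat -> set T') :
    [set p | forall i, (c i < (a + S * partial (bits A' p i) K 0)%:E)%E] =
    [set p | Q (word A' (K * n) p)].
  apply: eq_set => p; apply: eq_forall => i; congr (_ < (_ + _ * _)%:E)%E.
  apply: eq_bigr => k _; rewrite nth_rev_word//.
  by rewrite (@leq_trans (k.+1 * n))// ?leq_mul2r ?ltn_ord ?orbT// mulSnr ltn_add2l.
by rewrite !QE law.
Qed.

End Decode.

(** * Realizing a measure carried by a cube as the law of a decoded point *)

Section TransportDecode.
Context {R : realType} {n : nat}.
Context {d : measure_display} {T : measurableType d}.
Variables (P : {measure set T -> \bar R}) (mu : {measure set (borel 'rV[R]_n) -> \bar R}).
Hypotheses (Pfin : (P setT < +oo)%E) (Patomless : atomless P).
Hypothesis Pmu : P setT = mu setT.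

Lemma transport_decode (B : R) : 0 <= B ->
  mu [set x : 'rV[R]_n | exists i, B < `|x ord0 i|] = 0 ->
  exists2 A : nat -> set T, (forall j, measurable (A j)) &
    forall C : set (borel 'rV[R]_n), measurable C ->
      P [set p | C (decode (- B) (2 * B + 1) (bits A p))] = mu C.
Proof.
(* The extra 1 makes [(x ord0 i + B) / S < 1] on the closed cube, as the binary expansion requires,
   and keeps [S] positive when [B = 0]. *)
move=> B0 muB; set S := 2 * B + 1.
have S0 : 0 < S by rewrite /S; lra.
(* [E j] tests digit [j %/ n] of coordinate [j %% n], inverting the interleaving of [bits];
   quantifying over [i] avoids building an ordinal from [j %% n]. *)
pose E j : set (borel 'rV[R]_n) := [set x : 'rV[R]_n | forall i : 'I_n,
  i = (j %% n)%N :> nat -> digit ((x ord0 i + B) / S) (j %/ n)].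
have mE j : measurable (E j).
  rewrite (_ : E j = \bigcap_(i in [set i : 'I_n | i = (j %% n)%N :> nat])
    ((fun x : borel 'rV[R]_n => ((x : 'rV[R]_n) ord0 i + B) / S) @^-1`
       [set u | digit u (j %/ n)])); last first.
    by apply/seteqP; split => x H i => [|/(H i)//]; exact: H.
  apply: fin_bigcap_measurable; first exact: finite_finset.
  move=> i _; rewrite -[X in measurable X]setTI.
  have mi : measurable_fun [set: borel 'rV[R]_n]
      (fun x : borel 'rV[R]_n => ((x : 'rV[R]_n) ord0 i + B) / S).
    apply: measurable_funM => //; apply: measurable_funD => //.
    exact: measurable_coord.
  by apply: mi => //; exact: measurable_digit.
have [A [mA law]] := transport_bits Pfin Patomless Pmu mE.
exists A => // C mC.
have decE (x : 'rV[R]_n) : (forall i, `|x ord0 i| <= B) ->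
    decode (- B) S (bits E x) = x.
  move=> xB; apply/rowP => i; rewrite mxE.
  have -> : bits E x i = digit ((x ord0 i + B) / S).
    apply/funext => k; rewrite /bits /E.
    have n0 : (0 < n)%N by case: (n) i => // -[].
    apply/asboolP/idP => [/(_ i)|H j /=].
      by rewrite modnMDl modn_small// divnMDl// divn_small// addn0; apply.
    rewrite modnMDl modn_small// divnMDl// divn_small// addn0.
    by move=> /val_inj ->.
  have := xB i; rewrite ler_norml => /andP[x1 x2].
  rewrite limb_digit; first by field; apply: lt0r_neq0.
  apply/andP; split; first by apply: divr_ge0; [lra|exact: ltW].
  by rewrite ltr_pdivrMr// /S; lra.
pose f p := decode (- B) S (bits A p) : borel 'rV[R]_n.
have mf : measurable_fun setT f by exact: measurable_decode.
apply: (borel_rV_measure_unique (m1 := pushforward P f)) => //.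
move=> c; rewrite -[LHS]/(P [set p | orthant c (decode (- B) S (bits A p))]).
rewrite (@decode_law _ _ _ _ S0 _ _ _ _ P mu A E)//.
have mN := @measurable_outside_box R n B.
have mdE : @measurable _ (borel 'rV[R]_n) [set x | orthant c (decode (- B) S (bits E x))].
  rewrite -[X in measurable X]setTI.
  by apply: (measurable_decode (- B) S mE) => //; exact: measurable_orthant.
(* Decoding gives back [x] inside the cube; adding the null set outside it to both events makes them
   equal. *)
rewrite -(measureU0 mdE mN muB) -[RHS](measureU0 (measurable_orthant c) mN muB).
congr (mu _); apply/seteqP; split => x [H|]; try by right.
  have [/decE xE|/existsNP[i /negP]] := pselect (forall i, `|x ord0 i| <= B).
    by left; move: H; rewrite /= xE.
  by rewrite -ltNge => Bx; right; exists i.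
have [/decE xE|/existsNP[i /negP]] := pselect (forall i, `|x ord0 i| <= B).
  by left; rewrite /= xE.
by rewrite -ltNge => Bx; right; exists i.
Qed.

End TransportDecode.

(* [\int] is a supremum over simple functions, so monotonicity needs no
   measurability. *)
Lemma le_integral_nonmeasurable {d} {T : measurableType d} {R : realType}
    (mu : {measure set T -> \bar R}) (D : set T) (f g : T -> \bar R) :
  (forall x, D x -> (0 <= g x)%E) -> (forall x, D x -> (f x <= g x)%E) ->
  (\int[mu]_(x in D) f x <= \int[mu]_(x in D) g x)%E.
Proof.
move=> g0 fg; rewrite integralE.
apply: (@le_trans _ _ (\int[mu]_(x in D) f^\+ x)%E).
  by rewrite geeDl// oppe_le0; apply: integral_ge0 => x _; exact: funeneg_ge0.
rewrite !ge0_integralE//; apply: le_ereal_sup => _ [h hf <-]; exists h => // x.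
apply: le_trans (hf x) _; rewrite /patch; case: ifPn => // /set_mem Dx.
by rewrite funeposE ge_max fg// g0.
Qed.

(** * Nonnegative concave functions on the half-line *)

Section Concave.
Context {R : realType}.
Variable beta : R -> R.
Hypotheses (beta0 : forall w, 0 <= w -> 0 <= beta w) (betaC : concave_on_nonneg beta).

(** A drop from [v] to [w] would, by concavity, continue at least linearly and make [beta] negative
    far to the right. *)
Lemma concave_nondecr v w : 0 <= v -> v <= w -> beta v <= beta w.
Proof.
move=> v0; rewrite le_eqVlt => /predU1P[->//|vw].
rewrite leNgt; apply/negP => bwv.
(* The quotient is the factor at which the chord through [v] and [w] reaches 0; the added 1 gives
   strictness and [1 <= l]. *)
pose l := beta v / (beta v - beta w) + 1.
have d0 : 0 < beta v - beta w by rewrite subr_gt0.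
have l1 : 1 <= l by rewrite /l lerDr; apply: divr_ge0; [exact: beta0|exact: ltW].
have l0 : 0 < l by exact: lt_le_trans l1.
pose z := v + (w - v) * l.
have z0 : 0 <= z by apply: addr_ge0 => //; apply: mulr_ge0; rewrite ?subr_ge0; exact: ltW.
have li0 : 0 <= l^-1 by rewrite invr_ge0 ltW.
have li1 : l^-1 <= 1 by rewrite invf_le1.
have := betaC z0 v0 li0 li1.
have -> : l^-1 * z + (1 - l^-1) * v = w by rewrite /z; field; exact: lt0r_neq0.
have bz : 0 <= l^-1 * beta z by rewrite mulr_ge0// beta0.
suff : beta v * l^-1 < beta v - beta w by lra.
rewrite ltr_pdivrMr// /l mulrDr mulrCA mulfV ?lt0r_neq0//.
by rewrite !mulr1 ltrDl.
Qed.

(** [v] is the convex combination of [w] and [0] with weight [v / w] on [w], and [beta 0] is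
    nonnegative. *)
Lemma concave_ratio v w : 0 < v -> v <= w -> beta w / w <= beta v / v.
Proof.
move=> v0 vw; have w0 : 0 < w by exact: lt_le_trans vw.
rewrite ler_pdivrMr// mulrAC ler_pdivlMr//.
have t0 : 0 <= v / w by apply: divr_ge0; exact: ltW.
have t1 : v / w <= 1 by rewrite ler_pdivrMr// mul1r.
have := betaC (ltW w0) (lexx 0) t0 t1.
rewrite mulr0 addr0 divfK ?lt0r_neq0// => h.
have : v / w * beta w <= beta v.
  by apply: le_trans h; rewrite lerDl mulr_ge0 ?subr_ge0// beta0.
by rewrite mulrAC ler_pdivrMr// mulrC.
Qed.

(** Serves to pull the total mass [c] out of [beta], with [y = c + 1]. *)
Lemma concave_scale c x y : 1 <= y -> 0 <= c <= y -> 0 <= x ->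
  beta (c * x) <= y * beta x.
Proof.
move=> y1 /andP[c0 cy]; rewrite le_eqVlt => /predU1P[<-|x0].
  by rewrite mulr0 ler_peMl// beta0.
have y0 : 0 < y by exact: lt_le_trans y1.
apply: (@le_trans _ _ (beta (y * x))).
  by apply: concave_nondecr; rewrite ?mulr_ge0 ?ler_wpM2r// ltW.
have := concave_ratio x0 (ler_peMl (ltW x0) y1).
rewrite ler_pdivrMr ?mulr_gt0// mulrCA mulfVK ?lt0r_neq0//.
Qed.

End Concave.

(** * Dyadic sums: Jensen's inequality over words and the integral condition on [beta] *)

Fixpoint words (K : nat) : seq (seq bool) :=
  if K is K'.+1 then map (cons true) (words K') ++ map (cons false) (words K')
  else [:: [::]].

Lemma mem_words w : w \in words (size w).
Proof.
by elim: w => // -[] w IH /=; rewrite mem_cat map_f ?orbT.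
Qed.

(** Jensen by induction on the depth: midpoint concavity merges two siblings, and the induction
    hypothesis is applied to [2 * beta (x / 2)], again midpoint concave in [x]. *)
Lemma sum_beta_words {R : realType} (beta : R -> R) (g : seq bool -> R) K :
  (forall x y, 0 <= x -> 0 <= y -> beta x + beta y <= 2 * beta ((x + y) / 2)) ->
  (forall w, 0 <= g w) -> (forall w, g (true :: w) + g (false :: w) = g w) ->
  \sum_(w <- words K) beta (g w) <= 2 ^+ K * beta (g [::] / 2 ^+ K).
Proof.
move=> betaC g0 gS; elim: K beta betaC => [|K IH] beta betaC.
  by rewrite big_seq1 expr0 mul1r divr1.
rewrite /= big_cat/= !big_map -big_split/=.
apply: (@le_trans _ _ (\sum_(w <- words K) 2 * beta (g w / 2))).
  by apply: ler_sum => w _; rewrite (le_trans (betaC _ _ _ _))// gS.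
apply: le_trans (IH (fun x => 2 * beta (x / 2)) _) _.
  move=> x y x0 y0; rewrite -mulrDr ler_pM2l//.
  rewrite (_ : (x + y) / 2 / 2 = (x / 2 + y / 2) / 2); last by rewrite mulrDl.
  by apply: betaC; rewrite divr_ge0.
by rewrite mulrA exprSr invfM mulrA.
Qed.

Lemma concave_midpoint {R : realType} (beta : R -> R) : concave_on_nonneg beta ->
  forall x y, 0 <= x -> 0 <= y -> beta x + beta y <= 2 * beta ((x + y) / 2).
Proof.
move=> betaC x y x0 y0.
have h0 : 0 <= 2^-1 :> R by rewrite invr_ge0.
have h1 : 2^-1 <= 1 :> R by lra.
have := betaC x y _ x0 y0 h0 h1.
have -> : 2^-1 * x + (1 - 2^-1) * y = (x + y) / 2 by field.
by lra.
Qed.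

(** The exponent [k n (2 - 1/n) = k (2 n - 1)] is an integer. *)
Lemma half_exp_powR {R : realType} (n k : nat) : (0 < n)%N ->
  (2^-1 ^+ (k * n)) `^ (- (2 - n%:R^-1)) = 2 ^+ (k * (2 * n).-1) :> R.
Proof.
move=> n0; have n0' : n%:R != 0 :> R by rewrite pnatr_eq0 -lt0n.
rewrite -(@powR_mulrn _ 2^-1) ?invr_ge0// -powRrM.
have -> : (k * n)%:R * - (2 - n%:R^-1) = - (k * (2 * n).-1)%:R :> R.
  rewrite !natrM -subn1 natrB ?muln_gt0// natrM; field.
  exact: n0'.
by rewrite powRN powR_mulrn ?invr_ge0// exprVn invrK.
Qed.

(** On the interval [F k], [beta] is at least its value at the left end, the power weight at least
    its value at the right end, and the length at least [a k / 2]; up to the factor [2^n], the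
    product dominates the [k]-th term. *)
Lemma sum_beta_dyadic {R : realType} (beta : R -> R) (n : nat) : (0 < n)%N ->
  (forall w, 0 <= w -> 0 <= beta w) -> concave_on_nonneg beta ->
  (\int[lebesgue_measure]_(w in @oc01 R) (beta w * w `^ (- (2 - n%:R^-1)))%:E < +oo)%E ->
  (\sum_(0 <= k <oo)
     (2^-1 ^+ k.+1 * (2 ^+ (k.+1 * n) * beta (2^-1 ^+ (k.+1 * n))))%:E < +oo)%E.
Proof.
move=> n0 beta0 betaC.
pose a k : R := 2^-1 ^+ (k * n).
pose h k := beta (a k.+1) * 2 ^+ (k * (2 * n).-1).
pose F k : set R := `]a k.+1, a k]%classic.
have a0 k : 0 < a k by exact: half_exp_gt0.
have h0 k : 0 <= h k by rewrite mulr_ge0// ?exprn_ge0// beta0// ltW.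
have half_a k : a k.+1 * 2 <= a k.
  by rewrite /a -[leRHS]half_expS ler_pM2r// half_exp_le// mulSn; lia.
have ak1 k : a k <= 1 by rewrite -(expr0 2^-1) half_exp_le.
have FD k : F k `<=` @oc01 R.
  move=> w; rewrite /F/= in_itv/= => /andP[w1 w2]; apply/andP; split.
    exact: lt_trans w1.
  exact: le_trans (ak1 k).
have mD : measurable (@oc01 R).
  by rewrite (_ : @oc01 R = `]0, 1]%classic)//; apply/seteqP; split => w; rewrite /= in_itv.
(* The factor [(a K < w)] strengthens the induction: it forces the partial sum to vanish for
   [w <= a K], so [F K] is added only where nothing was counted before. *)
have lower w K : @oc01 R w ->
    \sum_(0 <= k < K) h k * \1_(F k) w <= beta w * w `^ (- (2 - n%:R^-1)) * (a K < w)%R%:R.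
  move=> /andP[w0 w1]; elim: K => [|K IH].
    by rewrite big_geq// !mulr_ge0 ?powR_ge0// beta0 ?ltW.
  rewrite big_nat_recr//=; have [aw|wa] := ltP (a K) w.
    have aw' : a K.+1 < w by rewrite (le_lt_trans _ aw)// (le_trans _ (half_a K))// ler_peMr ?ltW// ltr1n.
    rewrite indicE memNset ?mulr0 ?addr0 ?aw'; last first.
      by rewrite /F/= in_itv/= => /andP[_]; rewrite leNgt aw.
    by move: IH; rewrite aw.
  move: IH; rewrite ltNge wa/= mulr0 => IH.
  rewrite (_ : \sum_(0 <= k < K) _ = 0) ?add0r; last first.
    apply/eqP; rewrite eq_le IH/=.
    by apply: sumr_ge0 => k _; rewrite mulr_ge0//.
  have [aw|aw] := ltP (a K.+1) w; last first.
    rewrite indicE memNset ?mulr0//.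
    by rewrite /F/= in_itv/= => /andP[]; rewrite ltNge aw.
  rewrite indicE mem_set ?mulr1; last by rewrite /F/= in_itv/= aw.
  apply: ler_pM; rewrite ?exprn_ge0 ?beta0 ?(ltW (a0 _))//.
    by apply: concave_nondecr => //; rewrite ltW.
  rewrite -(half_exp_powR K n0) !powRN lef_pV2 ?posrE ?powR_gt0//.
  apply: ge0_ler_powR; rewrite ?nnegrE ?(ltW w0) ?(ltW (a0 _))//.
  by rewrite subr_ge0 (@le_trans _ _ 1)// ?ler1n// invf_le1 ?ler1n ?ltr0n.
move=> intH.
have mF k : measurable (F k) by exact: measurable_itv.
have lF k : lebesgue_measure (F k) = (a k - a k.+1)%:E.
  rewrite (@lebesgue_measure_itv R `]a k.+1, a k])/= lte_fin ifT//.
  by rewrite (lt_le_trans _ (half_a k))// ltr_pMr// ltr1n.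
have fin : (\sum_(0 <= k <oo) (h k * (a k - a k.+1))%:E < +oo)%E.
  apply: le_lt_trans intH.
  have -> : (\sum_(0 <= k <oo) (h k * (a k - a k.+1))%:E =
      \int[lebesgue_measure]_(w in @oc01 R) \sum_(0 <= k <oo) (h k * \1_(F k) w)%:E)%E.
    rewrite integral_nneseries//; last 2 first.
    - move=> k; apply/measurable_EFinP; apply: measurable_funM; first exact: measurable_cst.
      by apply: measurable_indic; exact: mF.
    - by move=> k w _; rewrite lee_fin mulr_ge0.
    apply: eq_eseriesr => k _.
    under eq_integral do rewrite EFinM.
    rewrite ge0_integralZl_EFin//; last first.
      by apply/measurable_EFinP; apply: measurable_indic; exact: mF.
    rewrite integral_indic//; last exact: mF.
    rewrite setIidl; last exact: FD.
    by rewrite EFinM; congr (_ * _)%E; exact/esym/lF.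
  apply: le_integral_nonmeasurable => w Dw.
    rewrite lee_fin mulr_ge0 ?powR_ge0// beta0//.
    by case/andP: Dw => /ltW.
  apply: lime_le.
    by apply: is_cvg_nneseries => k _ _; rewrite lee_fin mulr_ge0.
  near=> K; rewrite sumEFin lee_fin (le_trans (lower w K Dw))//.
  rewrite ler_piMr//; last by case: (_ < _).
  by rewrite mulr_ge0 ?powR_ge0// beta0//; case/andP: Dw => /ltW.
apply: (@le_lt_trans _ _ ((2 ^+ n)%:E * \sum_(0 <= k <oo) (h k * (a k - a k.+1))%:E)%E).
  rewrite -nneseriesZl; last first.
    move=> k _; rewrite lee_fin mulr_ge0// subr_ge0 (le_trans _ (half_a k))//.
    by rewrite ler_peMr ?ler1n// ltW.
  apply: lee_nneseries => k _.
    by move=> _; rewrite lee_fin !mulr_ge0 ?exprn_ge0 ?invr_ge0// beta0// exprn_ge0// invr_ge0.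
  rewrite -EFinM lee_fin /h -/(a k.+1).
  have -> : 2^-1 ^+ k.+1 * (2 ^+ (k.+1 * n) * beta (a k.+1)) =
      2 ^+ n * (beta (a k.+1) * 2 ^+ (k * (2 * n).-1) * (a k / 2)).
    rewrite /a; set y := 2^-1 ^+ (k * n).
    have -> : 2 ^+ (k * (2 * n).-1) = 2 ^+ (k * n) * 2 ^+ (k * n) * 2^-1 ^+ k :> R.
      apply: (@mulIf _ (2 ^+ k)); first by rewrite expf_neq0.
      rewrite -[RHS]mulrA -[2^-1 ^+ k * _]exprMn mulVf// expr1n mulr1 -!exprD; congr (_ ^+ _); nia.
    have -> : y = (2 ^+ (k * n))^-1 by rewrite /y exprVn.
    rewrite mulSn exprD exprS; field.
    by rewrite expf_neq0.
  rewrite ler_pM2l ?exprn_gt0//; apply: ler_wpM2l; first by rewrite -/(h k).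
  by have := half_a k; lra.
rewrite lte_mul_pinfty// ?lee_fin ?exprn_ge0//.
Unshelve. all: by end_near. Qed.

(** * Absolute continuity and speed of Lipschitz curves *)

Section Lipschitz.
Context {R : realType} {n : nat}.
Variables (f : R -> 'rV[R]_n) (C : R).
Hypotheses (C0 : 0 <= C)
  (f_lip : forall s t i, `|f s ord0 i - f t ord0 i| <= C * `|s - t|).

Lemma enorm_le (v : 'rV[R]_n) (c : R) :
  0 <= c -> (forall i, `|v ord0 i| <= c) -> enorm v <= n%:R * c.
Proof.
move=> c0 vc; rewrite /enorm -(@ger0_norm _ (n%:R * c)) ?mulr_ge0// -sqrtr_sqr.
apply: ler_wsqrtr; apply: (@le_trans _ _ (\sum_(i < n) c ^+ 2)).
  apply: ler_sum => i _; rewrite -[leLHS]real_normK ?num_real//.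
  by rewrite lerXn2r ?nnegrE// normr_ge0.
rewrite sumr_const card_ord exprMn -[leLHS]mulr_natl ler_wpM2r ?sqr_ge0//.
by case: (n) => [|k]; rewrite ?expr0n// expr2 ler_peMr// ler1n.
Qed.

Lemma lipschitz_abs_cont01 : abs_cont01 f.
Proof.
move=> e e0; have L0 : 0 < n%:R * C + 1 by rewrite ltr_wpDl// mulr_ge0.
exists (e / (n%:R * C + 1)); first exact: divr_gt0.
move=> k a b ab _; rewrite ltr_pdivlMr// mulrC mulr_sumr => lte.
apply: le_lt_trans lte; apply: ler_sum => i _; have [_ abi _] := ab i.
apply: (@le_trans _ _ (n%:R * (C * (b i - a i)))).
  apply: enorm_le => [|j]; first by rewrite mulr_ge0// subr_ge0.
  by rewrite !mxE -[b i - a i]ger0_norm ?subr_ge0.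
by rewrite mulrA ler_wpM2r ?subr_ge0// lerDl.
Qed.

(* Off the points of differentiability [derive1] is a limit that does not
   exist, hence the default value [point]. *)
Lemma lipschitz_derive1 (t : R) :
  enorm (derive1 f t) <= n%:R * C + enorm (point : 'rV[R]_n).
Proof.
have en0 (v : 'rV[R]_n) : 0 <= enorm v by exact: sqrtr_ge0.
have [c|nc] := pselect (exists l : 'rV[R]_n, (h^-1 *: (f (h + t) - f t) @[h --> 0^']) --> l); last first.
  rewrite /derive1 /lim /lim_in xgetPN ?lerDr ?mulr_ge0//.
  by move=> l Hl; apply: nc; exists l.
have {}c : (h^-1 *: (f (h + t) - f t) @[h --> 0^']) --> derive1 f t.
  by case: c => l cl; exact: (cvgP l cl).
apply: ler_wpDr => //; apply: enorm_le => // i.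
have ci : (h^-1 * (f (h + t) ord0 i - f t ord0 i)) @[h --> 0^'] --> derive1 f t ord0 i.
  rewrite (_ : (fun h => _) = (fun v : 'rV[R]_n => v ord0 i) \o
      (fun h => h^-1 *: (f (h + t) - f t))); last first.
    by apply/funext => h; rewrite /= !mxE.
  by apply: (cvg_comp _ _ c); exact: coord_continuous.
have bd h : `|h^-1 * (f (h + t) ord0 i - f t ord0 i)| <= C.
  have [->|h0] := eqVneq h 0; first by rewrite invr0 mul0r normr0.
  rewrite normrM normfV mulrC ler_pdivrMr ?normr_gt0//.
  by rewrite (le_trans (f_lip _ _ _))// addrK.
rewrite ler_norml; apply/andP; split.
  apply: (cvgr_to_ge ci); near=> h.
  by have := bd h; rewrite ler_norml => /andP[].
apply: (cvgr_to_le ci); near=> h.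
by have := bd h; rewrite ler_norml => /andP[].
Unshelve. all: by end_near. Qed.

End Lipschitz.

(** * Bounding the cost of one dyadic step, and of all of them *)

Section EnergyBound.
Context {R : realType} {n : nat} {Gamma : completePseudoMetricType R}.
Variables (P : {measure set (borel Gamma) -> \bar R}) (tau beta : R -> R) (L : R).
Hypotheses (Pfin : (P setT < +oo)%E) (L0 : 0 < L).
Hypotheses (beta0 : forall w, 0 <= w -> 0 <= beta w) (betaC : concave_on_nonneg beta).
Hypothesis tau_beta : forall w, 0 <= w -> tau w <= beta w.

Local Notation D := (setT `*` @I01 R : set (borel Gamma * R)).

(* The bound on the cost per unit of mass and time at points carrying mass at
   least [P B]; it is [+oo] when [B] is null. *)
Definition rate (B : set (borel Gamma)) : \bar R :=
  if P B == 0 then +oo%E else (L * (beta (fine (P B)) / fine (P B)))%:E.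

Lemma rate_ge0 B : (0 <= rate B)%E.
Proof.
rewrite /rate; case: eqP => // _; rewrite lee_fin mulr_ge0 ?(ltW L0)//.
by rewrite divr_ge0 ?beta0 ?fine_ge0.
Qed.

(** [mass] is an infimum over measurable supersets, so it is at least [P B], and [beta w / w] is
    nonincreasing. If [P B != 0], the mass is positive and [rtau] is the plain quotient. *)
Lemma cost_le_rate (chi : Gamma -> R -> 'rV[R]_n) (x : 'rV[R]_n)
    (B : set (borel Gamma)) (e : R) :
  measurable B -> B `<=` [set q | (chi q @` @I01 R) x] -> 0 <= e <= L ->
  (rtau tau (fine (mass P chi x)) * e%:E <= rate B)%E.
Proof.
move=> mB Bx /andP[e0 eL]; rewrite /rate; case: eqP => [_|/eqP PB]; first by rewrite leey.
set v := fine (P B); set w := fine (mass P chi x).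
have v0 : 0 < v by rewrite fine_gt0// lt0e PB measure_ge0/= -ge0_fin_numE// finite_measure_fin_num.
have massT : (mass P chi x <= P setT)%E.
  by apply: ereal_inf_lbound; exists setT.
have massB : (P B <= mass P chi x)%E.
  apply: le_ereal_inf_tmp => _ [C [mC xC] <-].
  by apply: le_measure; rewrite ?inE//; apply: subset_trans xC.
have mass_fin : mass P chi x \is a fin_num.
  by rewrite ge0_fin_numE ?(le_trans _ massB)// (le_lt_trans massT).
have vw : v <= w by rewrite fine_le// finite_measure_fin_num.
have w0 : 0 < w by exact: lt_le_trans vw.
rewrite /rtau gt_eqF// -EFinM lee_fin mulrC.
have bv0 : 0 <= beta v / v by rewrite divr_ge0// ?beta0// ltW.
apply: (@le_trans _ _ (e * (beta v / v))); last exact: ler_wpM2r.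
apply: ler_wpM2l => //; apply: le_trans (concave_ratio beta0 betaC v0 vw).
by rewrite ler_pM2r ?invr_gt0// tau_beta// ltW.
Qed.

Lemma measurable_I01 : measurable (@I01 R).
Proof.
rewrite (_ : @I01 R = `[0, 1]%classic); first exact: measurable_itv.
by apply/seteqP; split => w; rewrite /= in_itv.
Qed.

Lemma measurable_dom : measurable D.
Proof. by apply: measurableX => //; exact: measurable_I01. Qed.

(** If [P B = 0], the rectangle is null and [+oo * 0 = 0] removes the infinite rate; otherwise [P B]
    cancels the denominator of the rate. *)
Lemma integral_rate_rectangle (B : set (borel Gamma)) (J : set R) (l : R) :
  measurable B -> measurable J -> 0 <= l -> (lebesgue_measure J <= l%:E)%E ->
  (\int[(P \x lebesgue_measure)%E]_(z in D) (rate B * (\1_(B `*` J) z)%:E)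
     <= (L * l * beta (fine (P B)))%:E)%E.
Proof.
move=> mB mJ l0 Jl.
have mBJ : measurable (B `*` J : set (borel Gamma * R)) by exact: measurableX.
have mD := measurable_dom.
have r0 := rate_ge0 B.
rewrite ge0_integralZl//; last first.
  by apply/measurable_EFinP; exact: measurable_indic.
rewrite integral_indic//.
have le1 : ((P \x lebesgue_measure)%E ((B `*` J) `&` D) <= P B * l%:E)%E.
  apply: (@le_trans _ _ ((P \x lebesgue_measure)%E (B `*` J))).
    apply: le_measure; rewrite ?inE//.
    by apply: measurableI => //; exact: measurable_dom.
  by rewrite product_measure1E// lee_wpmul2l.
apply: le_trans (lee_wpmul2l (rate_ge0 B) le1) _.
rewrite /rate; case: eqP => [->|/eqP PB].
  by rewrite mul0e mule0 lee_fin !mulr_ge0// ?(ltW L0)// beta0.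
have PBf := finite_measure_fin_num Pfin mB.
rewrite -[in X in (_ * (X * _))%E](fineK PBf) -!EFinM lee_fin.
have v0 : fine (P B) != 0 by rewrite fine_eq0.
rewrite le_eqVlt; apply/orP; left; apply/eqP; field.
exact: v0.
Qed.

Variable A : nat -> set (borel Gamma).
Hypothesis mA : forall j, measurable (A j).

(** A majorant constant on rectangles, hence measurable and explicitly integrable. At a time in [J],
    only the cell containing the particle contributes. *)
Definition block (J : set R) (k : nat) (z : borel Gamma * R) : \bar R :=
  (\sum_(w <- words (k.+1 * n)) rate (cell A w) * (\1_(cell A w `*` J) z)%:E)%E.

Lemma block_ge0 J k z : (0 <= block J k z)%E.
Proof.
by apply: sume_ge0 => w _; apply: mule_ge0; rewrite ?rate_ge0// lee_fin.
Qed.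

Lemma rate_le_block (J : set R) k p t : J t ->
  (rate (cell A (word A (k.+1 * n) p)) <= block J k (p, t))%E.
Proof.
move=> Jt; rewrite /block.
have := mem_words (word A (k.+1 * n) p); rewrite size_word => /perm_to_rem perm_w.
rewrite (perm_big _ perm_w).
rewrite big_cons indicE mem_set; last by split => //=; exact: cell_word.
rewrite mule1 leeDl//.
by apply: sume_ge0 => w _; apply: mule_ge0; rewrite ?rate_ge0// lee_fin.
Qed.

Lemma measurable_rate_indic (B : set (borel Gamma)) (J : set R) :
  measurable B -> measurable J ->
  measurable_fun D (fun z => (rate B * (\1_(B `*` J) z)%:E)%E).
Proof.
move=> mB mJ; apply: emeasurable_funM; first exact: measurable_cst.
by apply/measurable_EFinP; apply: measurable_indic; exact: measurableX.
Qed.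

Lemma measurable_block (J : set R) k : measurable J -> measurable_fun D (block J k).
Proof.
move=> mJ; apply: emeasurable_sum => w.
by apply: measurable_rate_indic => //; exact: measurable_cell.
Qed.

Lemma integral_block (J : set R) k (l : R) :
  measurable J -> 0 <= l -> (lebesgue_measure J <= l%:E)%E ->
  (\int[(P \x lebesgue_measure)%E]_(z in D) block J k z <=
   (L * (fine (P setT) + 1))%:E *
     (l * (2 ^+ (k.+1 * n) * beta (2^-1 ^+ (k.+1 * n))))%:E)%E.
Proof.
move=> mJ l0 Jl; have mC := measurable_cell mA.
have mD := measurable_dom.
rewrite ge0_integral_sum//; last 2 first.
- by move=> w; exact: measurable_rate_indic.
- by move=> w z _; apply: mule_ge0; rewrite ?rate_ge0// lee_fin.
apply: (@le_trans _ _ (\sum_(w <- words (k.+1 * n)) (L * l * beta (fine (P (cell A w))))%:E)%E).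
  by apply: lee_sum => w _; exact: integral_rate_rectangle.
rewrite sumEFin -mulr_sumr -EFinM lee_fin.
set m := (k.+1 * n)%N.
have := @sum_beta_words R beta (fun w => fine (P (cell A w))) m (concave_midpoint betaC).
move=> /(_ (fun w => fine_ge0 (measure_ge0 _ _))) sumw.
(* The total mass inside [beta] is traded for a factor; the added 1 makes that factor at least 1, as
   [concave_scale] demands. *)
apply: (@le_trans _ _ (L * l * (2 ^+ m * ((fine (P setT) + 1) * beta (2^-1 ^+ m))))).
  apply: ler_wpM2l; first by rewrite mulr_ge0// ltW.
  apply: le_trans (sumw _) _.
    move=> w; rewrite cell_cons_false cell_cons_true.
    rewrite measureD//; last by rewrite -ge0_fin_numE// finite_measure_fin_num.
    have mI : measurable (cell A w `&` A (size w)) by exact: measurableI.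
    by rewrite fineB ?finite_measure_fin_num// addrC subrK.
  rewrite ler_pM2l ?exprn_gt0// cell_nil -exprVn.
  apply: concave_scale => //; rewrite ?exprn_ge0 ?invr_ge0//.
    by rewrite lerDr fine_ge0.
  by rewrite fine_ge0//= lerDl.
by rewrite le_eqVlt; apply/orP; left; apply/eqP; ring.
Qed.

Lemma integral_series_block (J : nat -> set R) :
  (0 < n)%N ->
  (\int[lebesgue_measure]_(w in @oc01 R) (beta w * w `^ (- (2 - n%:R^-1)))%:E < +oo)%E ->
  (forall k, measurable (J k)) ->
  (forall k, (lebesgue_measure (J k) <= (2^-1 ^+ k.+1)%:E)%E) ->
  (\int[(P \x lebesgue_measure)%E]_(z in D) \sum_(0 <= k <oo) block (J k) k z < +oo)%E.
Proof.
move=> n0 intb mJ Jl.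
have Jl0 k : 0 <= 2^-1 ^+ k.+1 :> R by rewrite exprn_ge0// invr_ge0.
have t0 k : 0 <= 2^-1 ^+ k.+1 * (2 ^+ (k.+1 * n) * beta (2^-1 ^+ (k.+1 * n))).
  by rewrite !mulr_ge0 ?exprn_ge0// beta0// exprn_ge0// invr_ge0.
have mD := measurable_dom.
rewrite integral_nneseries//; last 2 first.
- by move=> k; exact: measurable_block.
- by move=> k z _; exact: block_ge0.
apply: (@le_lt_trans _ _ (\sum_(0 <= k <oo) ((L * (fine (P setT) + 1))%:E *
     (2^-1 ^+ k.+1 * (2 ^+ (k.+1 * n) * beta (2^-1 ^+ (k.+1 * n))))%:E))%E).
  apply: lee_nneseries => k _; last exact: integral_block.
  by move=> _; apply: integral_ge0 => z _; exact: block_ge0.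
rewrite nneseriesZl; last by move=> k _; rewrite lee_fin.
have C0 : 0 <= L * (fine (P setT) + 1).
  by rewrite mulr_ge0 ?(ltW L0)// addr_ge0// fine_ge0.
by rewrite lte_mul_pinfty// sum_beta_dyadic.
Qed.

End EnergyBound.

(** * The tree pattern and the finiteness of its cost *)

Lemma dyadic_bracket {R : realType} (s : R) : 0 < s <= 1 ->
  exists k, 2^-1 ^+ k.+1 <= s <= 2^-1 ^+ k.
Proof.
move=> /andP[s0 s1].
have ex : exists k, 2^-1 ^+ k <= s.
  have : 2^-1 ^+ k @[k --> \oo] --> (0 : R).
    by apply: cvg_expr; rewrite ger0_norm ?invr_ge0// invf_lt1// ltr1n.
  move=> /cvgrPdist_lt /(_ s s0)[N _ /(_ N (leqnn N))].
  by rewrite sub0r normrN ger0_norm ?(ltW (half_exp_gt0 _))// => /ltW; exists N.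
(* The minimal exponent is 0 only for [s = 1], which belongs to the bracket [[1/2, 1]]. *)
case: (ex_minnP ex) => -[|k] ks kmin.
  by exists 0%N; rewrite s1 (le_trans _ ks)// half_exp_le.
exists k; rewrite ks /=; apply: ltW; rewrite ltNge; apply/negP => /kmin.
by rewrite ltnn.
Qed.

Section Pattern.
Context {R : realType} {n : nat} {Gamma : completePseudoMetricType R}.
Variables (Ap Am : nat -> set (borel Gamma)) (a S : R).
Hypotheses (S0 : 0 < S) (mAp : forall j, measurable (Ap j))
  (mAm : forall j, measurable (Am j)).

(* Each particle climbs from [decode a S (bits Ap p)] up its dyadic tree to the
   root (reached at time [1/2]) and down again to [decode a S (bits Am p)]. *)
Definition pattern (p : Gamma) (t : R) : 'rV[R]_n :=
  \row_i (a + S * (limb (bits Ap p i) (2 * t) + limb (bits Am p i) (2 - 2 * t))).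

Lemma pattern0 p : pattern p 0 = decode a S (bits Ap p).
Proof.
apply/rowP => i; rewrite !mxE mulr0 subr0 [limb (bits Am p i) _]limb_ge1 ?addr0//.
by rewrite ler1n.
Qed.

Lemma pattern1 p : pattern p 1 = decode a S (bits Am p).
Proof.
apply/rowP => i; rewrite !mxE mulr1 subrr [limb (bits Ap p i) _]limb_ge1 ?add0r//.
by rewrite ler1n.
Qed.

(** Each [limb] is 1-Lipschitz and its argument moves at rate 2; the bounds of the two legs are
    added. *)
Lemma pattern_lip p s t i :
  `|pattern p s ord0 i - pattern p t ord0 i| <= (4 * S) * `|s - t|.
Proof.
rewrite !mxE opprD addrACA subrr add0r -mulrBr normrM (gtr0_norm S0).
rewrite [4 * S]mulrC -mulrA ler_pM2l// opprD addrACA.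
apply: le_trans (ler_normD _ _) _.
have hp := limb_lip (bits Ap p i) (2 * s) (2 * t).
have hm := limb_lip (bits Am p i) (2 - 2 * s) (2 - 2 * t).
have ep : `|2 * s - 2 * t| = 2 * `|s - t| by rewrite -mulrBr normrM ger0_norm.
have em : `|(2 - 2 * s) - (2 - 2 * t)| = 2 * `|s - t|.
  by rewrite -ep -normrN; congr `|_|; ring.
by rewrite ep in hp; rewrite em in hm; lra.
Qed.

Lemma measurable_pattern : measurable_fun (setT `*` @I01 R)
  (fun z : borel Gamma * R => (pattern z.1 z.2 : borel 'rV[R]_n)).
Proof.
apply: measurable_fun_rV; first exact: measurable_dom.
move=> i; apply: (@measurable_funS _ _ _ _ setT) => //.
rewrite [X in measurable_fun _ X](_ : _ = fun z : borel Gamma * R =>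
  a + S * (limb (bits Ap z.1 i) (2 * z.2) + limb (bits Am z.1 i) (2 - 2 * z.2))); last first.
  by apply/funext => z; rewrite mxE.
have m2 : measurable_fun [set: borel Gamma * R] (fun z => 2 * z.2).
  by apply: measurable_funM => //; exact: measurable_snd.
apply: measurable_funD => //; apply: measurable_funM => //; apply: measurable_funD.
  apply: measurable_limb => // k.
  apply: (@measurableT_comp _ _ _ _ _ _ (fun p : borel Gamma => (bits Ap p i k)%:R : R)) => //.
  exact: measurable_bits.
apply: measurable_limb => // [k|]; last exact: measurable_funB.
apply: (@measurableT_comp _ _ _ _ _ _ (fun p : borel Gamma => (bits Am p i k)%:R : R)) => //.
exact: measurable_bits.
Qed.

(** While [t <= 1/2], the [Am] term has argument at least 1 and vanishes, so only the leading bits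
    of [Ap] matter. *)
Lemma pattern_eq_up K p q t : 2^-1 ^+ K <= 2 * t -> t <= 2^-1 ->
  word Ap (K * n) p = word Ap (K * n) q -> pattern p t = pattern q t.
Proof.
move=> Kt t2 wpq; apply/rowP => i; rewrite !mxE.
rewrite ![limb (bits Am _ i) _]limb_ge1; try lra.
congr (_ + _ * (_ + _)); apply: limb_agree Kt _ => k kK.
exact: bits_eq kK wpq.
Qed.

Lemma pattern_eq_down K p q t : 2^-1 ^+ K <= 2 - 2 * t -> 2^-1 <= t ->
  word Am (K * n) p = word Am (K * n) q -> pattern p t = pattern q t.
Proof.
move=> Kt t2 wpq; apply/rowP => i; rewrite !mxE.
rewrite ![limb (bits Ap _ i) _]limb_ge1; try lra.
congr (_ + _ * (_ + _)); apply: limb_agree Kt _ => k kK.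
exact: bits_eq kK wpq.
Qed.

Variables (P : {measure set (borel Gamma) -> \bar R}) (tau beta : R -> R).
Hypotheses (n0 : (0 < n)%N) (Pfin : (P setT < +oo)%E).
Hypotheses (beta0 : forall w, 0 <= w -> 0 <= beta w) (betaC : concave_on_nonneg beta).
Hypothesis tau_beta : forall w, 0 <= w -> tau w <= beta w.
Hypothesis beta_int : (\int[lebesgue_measure]_(w in @oc01 R)
  (beta w * w `^ (- (2 - n%:R^-1)))%:E < +oo)%E.

Lemma Jtau_pattern_lty : (Jtau P tau pattern < +oo)%E.
Proof.
(* [L] bounds the speed; its second summand covers the times without derivative, where [derive1]
   takes the default value. *)
pose L := n%:R * (4 * S) + enorm (point : 'rV[R]_n).
have L0 : 0 < L by rewrite ltr_wpDr ?sqrtr_ge0// !mulr_gt0// ltr0n.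
(* On [up k], [2 * t] lies in [[2^-(k+1), 2^-k]], so particles sharing [(k+1) n] bits coincide;
   [down k] is the mirror image under [1 - t]. *)
pose up k : set R := `[2^-1 ^+ k.+2, 2^-1 ^+ k.+1]%classic.
pose down k : set R := `[1 - 2^-1 ^+ k.+1, 1 - 2^-1 ^+ k.+2]%classic.
have lup k : (lebesgue_measure (up k) <= (2^-1 ^+ k.+1)%:E)%E.
  rewrite (@lebesgue_measure_itv R `[2^-1 ^+ k.+2, 2^-1 ^+ k.+1])/=.
  case: ifP => _; rewrite lee_fin.
    by rewrite gerBl ltW// half_exp_gt0.
  by rewrite ltW// half_exp_gt0.
have ldown k : (lebesgue_measure (down k) <= (2^-1 ^+ k.+1)%:E)%E.
  rewrite (@lebesgue_measure_itv R `[1 - 2^-1 ^+ k.+1, 1 - 2^-1 ^+ k.+2])/=.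
  case: ifP => _; rewrite lee_fin.
    by have := half_exp_gt0 (R := R) k.+2; lra.
  by rewrite ltW// half_exp_gt0.
have mup k : measurable (up k) by exact: measurable_itv.
have mdown k : measurable (down k) by exact: measurable_itv.
pose Gu z := (\sum_(0 <= k <oo) @block R n Gamma P beta L Ap (up k) k z)%E.
pose Gd z := (\sum_(0 <= k <oo) @block R n Gamma P beta L Am (down k) k z)%E.
(* The times 0 and 1 lie in no [up k] or [down k]; the majorant [G] is set to [+oo] there, on a null
   set. *)
pose N : set (borel Gamma * R) := setT `*` [set 0; 1].
pose G z := (Gu z + (Gd z + +oo * (\1_N z)%:E))%E.
have Gu0 z : (0 <= Gu z)%E by apply: nneseries_ge0 => k _ _; exact: block_ge0.
have Gd0 z : (0 <= Gd z)%E by apply: nneseries_ge0 => k _ _; exact: block_ge0.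
have N0 z : (0 <= +oo * (\1_N z)%:E :> \bar R)%E by rewrite mule_ge0// lee_fin.
have mN : measurable N.
  by apply: measurableX => //; apply: measurableU; exact: measurable_set1.
apply: (@le_lt_trans _ _ (\int[(P \x lebesgue_measure)%E]_(z in setT `*` @I01 R) G z)%E).
  apply: le_integral_nonmeasurable => [z _|[p t] [_ /= t01]].
    by rewrite !adde_ge0.
  have e0L : 0 <= enorm (derive1 (pattern p) t) <= L.
    rewrite sqrtr_ge0/=; apply: lipschitz_derive1; first by rewrite mulr_ge0// ltW.
    exact: pattern_lip.
  have /andP[t0 t1] := t01.
  have [tE|tN] := pselect ([set 0; 1] t).
    rewrite (_ : G (p, t) = +oo%E) ?leey// /G indicE mem_set//.
    by rewrite mule1 !addeA addey// gt_eqF// (lt_le_trans (ltNyr 0))// adde_ge0.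
  have tlt0 : 0 < t by rewrite lt_neqAle t0 andbT eq_sym; apply/eqP => t_; apply: tN; left.
  have tlt1 : t < 1 by rewrite lt_neqAle t1 andbT; apply/eqP => t_; apply: tN; right.
  have [t2|t2] := leP t 2^-1.
    have [|k /andP[k1 k2]] := @dyadic_bracket R (2 * t); first by apply/andP; split; lra.
    have upt : up k t.
      rewrite /up/= in_itv/=; have := half_expS (R := R) k; have := half_expS (R := R) k.+1.
      by move=> h1 h2; apply/andP; split; lra.
    apply: (@le_trans _ _ (rate P beta L (cell Ap (word Ap (k.+1 * n) p)))).
      apply: cost_le_rate => //; first exact: measurable_cell.
      move=> q; rewrite /cell/= size_word => wq; exists t => //.
      exact: pattern_eq_up wq.
    apply: (@le_trans _ _ (@block R n Gamma P beta L Ap (up k) k (p, t))).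
      exact: rate_le_block.
    apply: (@le_trans _ _ (Gu (p, t))); last by rewrite leeDl// adde_ge0.
    apply: le_trans (nneseries_lim_ge k.+1 _); last by move=> *; exact: block_ge0.
    by rewrite big_nat_recr//= leeDr// sume_ge0// => j _; exact: block_ge0.
  have [|k /andP[k1 k2]] := @dyadic_bracket R (2 - 2 * t); first by apply/andP; split; lra.
  have dt : down k t.
    rewrite /down/= in_itv/=; have := half_expS (R := R) k; have := half_expS (R := R) k.+1.
    by move=> h1 h2; apply/andP; split; lra.
  apply: (@le_trans _ _ (rate P beta L (cell Am (word Am (k.+1 * n) p)))).
    apply: cost_le_rate => //; first exact: measurable_cell.
    move=> q; rewrite /cell/= size_word => wq; exists t => //.
    by apply: pattern_eq_down wq => //; exact: ltW.
  apply: (@le_trans _ _ (@block R n Gamma P beta L Am (down k) k (p, t))).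
    exact: rate_le_block.
  apply: (@le_trans _ _ (Gd (p, t))); last by rewrite /G addeCA leeDl// adde_ge0.
  apply: le_trans (nneseries_lim_ge k.+1 _); last by move=> *; exact: block_ge0.
  by rewrite big_nat_recr//= leeDr// sume_ge0// => j _; exact: block_ge0.
have mD := @measurable_dom R Gamma.
have mGu : measurable_fun (setT `*` @I01 R) Gu.
  apply: ge0_emeasurable_sum => [k z _ _|k _]; first exact: block_ge0.
  exact: measurable_block.
have mGd : measurable_fun (setT `*` @I01 R) Gd.
  apply: ge0_emeasurable_sum => [k z _ _|k _]; first exact: block_ge0.
  exact: measurable_block.
have m1N : measurable_fun (setT `*` @I01 R) (fun z => (\1_N z : R)%:E).
  by apply/measurable_EFinP; exact: measurable_indic.
have mNoo : measurable_fun (setT `*` @I01 R) (fun z => (+oo * (\1_N z)%:E : \bar R)%E).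
  by apply: emeasurable_funM => //; exact: measurable_cst.
rewrite ge0_integralD//; last 2 first.
- by move=> z _; rewrite adde_ge0.
- exact: emeasurable_funD.
rewrite ge0_integralD//.
rewrite lte_add_pinfty//; first exact: integral_series_block.
rewrite lte_add_pinfty//; first exact: integral_series_block.
rewrite ge0_integralZl//.
rewrite integral_indic//.
suff m0 : (P \x lebesgue_measure)%E (N `&` (setT `*` @I01 R)) = 0%E.
  by rewrite [X in (_ * X)%E]m0 mule0.
apply/eqP; rewrite eq_le measure_ge0 andbT.
apply: (@le_trans _ _ ((P \x lebesgue_measure)%E N)).
  by apply: le_measure; rewrite ?inE//; apply: measurableI.
have m01 : measurable ([set 0; 1] : set R).
  by apply: measurableU; exact: measurable_set1.
have l01 : lebesgue_measure ([set 0; 1] : set R) = 0%E.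
  by apply: countable_lebesgue_measure0; apply: finite_set_countable.
by rewrite product_measure1E// [X in (_ * X)%E]l01 mule0.
Qed.

End Pattern.

Theorem mainTheorem11 (R : realType) (n : nat) (tau : R -> R)
    (Gamma : completePseudoMetricType R)
    (P : {measure set (borel Gamma) -> \bar R})
    (mup mum : {measure set (borel 'rV[R]_n) -> \bar R}) :
  (0 < n)%N ->
  admissible n tau ->
  reference_space P ->
  (mup setT < +oo)%E ->
  mup setT = mum setT ->
  bounded_set (msupport mup) ->
  bounded_set (msupport mum) ->
  P setT = mup setT ->
  exists chi : Gamma -> R -> 'rV[R]_n,
    irrigation_pattern P chi /\ (Jtau_mu P tau mup mum chi < +oo)%E.
Proof.
move=> n0 [_ [beta [beta0 betaC tau_beta beta_int]]] [_ _ _ _ Patomless].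
move=> mupfin mupm bp bm Pmup.
have Pfin : (P setT < +oo)%E by rewrite Pmup.
have [Mp Hp] := bounded_msupport_null bp.
have [Mm Hm] := bounded_msupport_null bm.
(* One [B] serves both measures, so that the two trees live in the same cube and share their root,
   the corner with all coordinates [- B]. *)
pose B := Num.max 0 (Num.max Mp Mm).
have B0 : 0 <= B by rewrite le_max lexx.
have [|Ap mAp lawp] := @transport_decode R n _ _ P mup Pfin Patomless Pmup B B0.
  by apply: Hp; rewrite !le_max lexx orbT.
have Pmum : P setT = mum setT by rewrite Pmup.
have [|Am mAm lawm] := @transport_decode R n _ _ P mum Pfin Patomless Pmum B B0.
  by apply: Hm; rewrite !le_max lexx !orbT.
have S0 : 0 < 2 * B + 1 by lra.
pose chi := @pattern R n Gamma Ap Am (- B) (2 * B + 1).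
exists chi; split; last first.
  rewrite /Jtau_mu asboolT; last first.
    split=> C mC; rewrite /pushforward.
      rewrite -lawp//; congr (P _); apply/funext => p.
      by rewrite /preimage/= /chi pattern0.
    rewrite -lawm//; congr (P _); apply/funext => p.
    by rewrite /preimage/= /chi pattern1.
  exact: (@Jtau_pattern_lty _ _ _ _ _ _ _ S0 mAp mAm P tau beta).
split; first exact: measurable_pattern.
(* Every trajectory is Lipschitz, so the exceptional set can be taken empty. *)
exists set0; split => //.
move=> p /= nac; exfalso; apply: nac.
apply: (@lipschitz_abs_cont01 _ _ _ (4 * (2 * B + 1))); first by rewrite mulr_ge0// ltW.
exact: pattern_lip.
Qed.
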